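(* Let $\Omega$ be a nc subset of $\mathcal S_{\rm nc}$ for some set $\mathcal S$, let $\mathcal Y$ be a Hilbert space, let $\mathcal A$ be a unital $C^*$-algebra, and let $K\colon \Omega\times\Omega\to \mathcal L(\mathcal A,\mathcal L(\mathcal Y))_{\rm nc}$ be a given (graded) function, i.e. $K(Z,W)$ is a linear map $\mathcal A^{n\times m}\to\mathcal L(\mathcal Y)^{n\times m}$ for $Z\in\Omega_n$, $W\in\Omega_m$. Then the following are equivalent. (1) $K$ is a cp global kernel. (2) There is a Hilbert space $\mathcal H(K)$ whose elements are global functions $f\colon\Omega\to\mathcal L(\mathcal A,\mathcal Y)_{\rm nc}$ such that: (a) for each $W\in\Omega_m$, $v\in\mathcal A^{1\times m}$, $y\in\mathcal Y^m$ ($m\in\mathbb N$), the function $K_{W,v,y}$ defined by $K_{W,v,y}(Z)u=K(Z,W)(uv)y$ for $Z\in\Omega_n$, $u\in\mathcal A^n$, belongs to $\mathcal H(K)$; (b) for all $f\in\mathcal H(K)$, $W\in\Omega_m$, $v\in\mathcal A^{1\times m}$, $y\in\mathcal Y^m$, $$\langle f(W)(v^* ),y\rangle_{\mathcal Y^m}=\langle f,K_{W,v,y}\rangle_{\mathcal H(K)};$$ (c) $\mathcal H(K)$ is equipped with a unital $*$-representation $\sigma\colon\mathcal A\to\mathcal L(\mathcal H(K))$ such that $(\sigma(a)f)(W)(v^* )=f(W)(v^*a)$ for $a\in\mathcal A$, $f\in\mathcal H(K)$, $W\in\Omega_m$, $v\in\mathcal A^{1\times m}$, with action on kernel elements given by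 $\sigma(a)K_{W,v,y}=K_{W,av,y}$. (3) $K$ has a Kolmogorov decomposition: there is a Hilbert space $\mathcal X$ equipped with a unital $*$-representation $\sigma\colon\mathcal A\to\mathcal L(\mathcal X)$ together with a global function $H\colon\Omega\to\mathcal L(\mathcal X,\mathcal Y)_{\rm nc}$ such that $$K(Z,W)(P)=H(Z)\,(\mathrm{id}_{\mathbb C^{n\times m}}\otimes\sigma)(P)\,H(W)^*$$ for all $Z\in\Omega_n$, $W\in\Omega_m$, $P\in\mathcal A^{n\times m}$. Furthermore, statements (1), (2), (3) remain equivalent if it is assumed that $\Omega\subset\mathcal V_{\rm nc}$ for a complex vector space $\mathcal V$, $K$ is taken to be a cp nc kernel in (1), the elements $f$ of $\mathcal H(K)$ are taken to be nc functions from $\Omega$ to $\mathcal L(\mathcal A,\mathcal Y)_{\rm nc}$ in (2), and $H$ is taken to be a nc function from $\Omega$ to $\mathcal L(\mathcal X,\mathcal Y)_{\rm nc}$ in (3).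
   Context: For a set $\mathcal S$, $\mathcal S_{\rm nc}=\coprod_{n\ge1}\mathcal S^{n\times n}$ (disjoint union of square matrices over $\mathcal S$). For $\Omega\subset\mathcal S_{\rm nc}$ put $\Omega_n=\Omega\cap\mathcal S^{n\times n}$. $\Omega$ is a nc set if it is closed under direct sums: $Z\in\Omega_n$, $W\in\Omega_m$ imply $\begin{bmatrix}Z&0\\0&W\end{bmatrix}\in\Omega_{n+m}$ (when $\mathcal S$ is a bare set the zero blocks are formal). $\mathcal L(\mathcal X,\mathcal Y)$ denotes bounded linear operators and $\mathcal L(\mathcal X,\mathcal Y)^{n\times n}$ is identified with $\mathcal L(\mathcal X^n,\mathcal Y^n)$. A function $f\colon\Omega\to\mathcal L(\mathcal X,\mathcal Y)_{\rm nc}$ is a global function if it is graded ($f(Z)\in\mathcal L(\mathcal X,\mathcal Y)^{n\times n}$ for $Z\in\Omega_n$) and respects direct sums: $f\left(\begin{bmatrix}Z&0\\0&W\end{bmatrix}\right)=\begin{bmatrix}f(Z)&0\\0&f(W)\end{bmatrix}$. If $\Omega\subset\mathcal V_{\rm nc}$ with $\mathcal V$ a complex vector space, $f$ is a nc function if it is graded and respects intertwinings: $Z\in\Omega_n$, $\widetilde Z\in\Omega_m$, $\alpha\in\mathbb C^{m\times n}$, $\alpha Z=\widetilde Z\alpha$ imply $\alpha f(Z)=f(\widetilde Z)\alpha$. A function $K\colon\Omega\times\Omega\to\mathcal L(\mathcal A,\mathcal L(\mathcal Y))_{\rm nc}$ is graded if for $Z\in\Omega_n$, $W\in\Omega_m$,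 $K(Z,W)$ is a linear map $\mathcal A^{n\times m}\to\mathcal L(\mathcal Y)^{n\times m}\cong\mathcal L(\mathcal Y^m,\mathcal Y^n)$. It is a global kernel if it is graded and respects direct sums: $$K\left(\begin{bmatrix}Z&0\\ 0&\widetilde Z\end{bmatrix},\begin{bmatrix}W&0\\ 0&\widetilde W\end{bmatrix}\right)\left(\begin{bmatrix}P_{11}&P_{12}\\ P_{21}&P_{22}\end{bmatrix}\right)=\begin{bmatrix}K(Z,W)(P_{11})&K(Z,\widetilde W)(P_{12})\\ K(\widetilde Z,W)(P_{21})&K(\widetilde Z,\widetilde W)(P_{22})\end{bmatrix}.$$ If $\Omega\subset\mathcal V_{\rm nc}$ with $\mathcal V$ a complex vector space, $K$ is a nc kernel if it is graded and: $Z\in\Omega_n$, $\widetilde Z\in\Omega_{\tilde n}$, $\alpha\in\mathbb C^{\tilde n\times n}$ with $\alpha Z=\widetilde Z\alpha$, $W\in\Omega_m$, $\widetilde W\in\Omega_{\tilde m}$, $\beta\in\mathbb C^{\tilde m\times m}$ with $\beta W=\widetilde W\beta$, $P\in\mathcal A^{n\times m}$ imply $\alpha K(Z,W)(P)\beta^*=K(\widetilde Z,\widetilde W)(\alpha P\beta^* )$. A global (resp. nc) kernel is completely positive (a cp global, resp. cp nc, kernel) if $K(Z,Z)(P)\succeq0$ whenever $Z\in\Omega_n$, $P\succeq0$ in $\mathcal A^{n\times n}$, $n\in\mathbb N$. $\mathcal A^n$ denotes columns and $\mathcal A^{1\times m}$ rows over $\mathcal A$; for a matrix $V$ over $\mathcal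 A$, $V^*$ is the conjugate transpose (so $v^*\in\mathcal A^m$ for $v\in\mathcal A^{1\times m}$); $uv$ is the matrix product. $(\mathrm{id}_{\mathbb C^{n\times m}}\otimes\sigma)([P_{ij}])=[\sigma(P_{ij})]$. *)

(* Defs.v *)
From HB Require Import structures.
From mathcomp Require Import all_boot all_order all_algebra complex.
From mathcomp Require Import all_classical all_reals.
From mathcomp Require Import topology normedtype.

Set Implicit Arguments.
Unset Strict Implicit.
Unset Printing Implicit Defensive.

Import Order.TTheory GRing.Theory Num.Theory.
Import numFieldNormedType.Exports.

Local Open Scope classical_set_scope.
Local Open Scope ring_scope.

(* The definitions are parameterized by [C : numClosedFieldType], to be
   instantiated with the field [R[i]] of complex numbers, [R : realType]. *)

(* Inner products are linear in the first argument. *)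
HB.mixin Record CompleteNormedModule_isHilbert (C : numClosedFieldType) V
    & CompleteNormedModule C V := {
  hdot : {dot V for (@Num.conj C : C -> C)} ;
  hdot_norm : forall x : V, `|x| ^+ 2 = hdot x x }.

#[short(type="hilbertType")]
HB.structure Definition Hilbert (C : numClosedFieldType) :=
  {V of CompleteNormedModule_isHilbert C V & CompleteNormedModule C V}.

(* The library has no structure combining [GRing.Algebra] with a norm, and
   joining [GRing.Algebra] with [NormedModule] would clash with
   [Num.NumDomain], in which the norm of a ring takes its values in that ring.
   Hence an algebra norm is a separate operation [algnorm], and [normed A] is
   A, seen as a normed module for [algnorm]. *)
HB.mixin Record Algebra_isNormed (C : numClosedFieldType) A
    & GRing.Algebra C A := {
  algnorm : A -> C ;
  algnormD : forall x y : A, algnorm (x + y) <= algnorm x + algnorm y ;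
  algnormZ : forall (c : C) (x : A), algnorm (c *: x) = `|c| * algnorm x ;
  algnorm0_eq0 : forall x : A, algnorm x = 0 -> x = 0 ;
  algnormM : forall x y : A, algnorm (x * y) <= algnorm x * algnorm y }.

#[short(type="normedAlgType")]
HB.structure Definition NormedAlgebra (C : numClosedFieldType) :=
  {A of Algebra_isNormed C A & GRing.Algebra C A}.

Definition normed (C : numClosedFieldType) (A : normedAlgType C) : Type := A.

HB.instance Definition _ (C : numClosedFieldType) (A : normedAlgType C) :=
  GRing.Lmodule.on (normed A).
HB.instance Definition _ (C : numClosedFieldType) (A : normedAlgType C) :=
  Lmodule_isNormed.Build C (normed A)
    (@algnormD C A) (@algnormZ C A) (@algnorm0_eq0 C A).

HB.mixin Record NormedAlgebra_isCStar (C : numClosedFieldType) A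
    & NormedAlgebra C A := {
  cstar_complete : forall F : set_system (normed A),
    ProperFilter F -> cauchy F -> cvg F ;
  star : A -> A ;
  starK : involutive star ;
  starD : {morph star : x y / x + y} ;
  starZ : forall (c : C) (x : A), star (c *: x) = c^* *: star x ;
  starM : forall x y : A, star (x * y) = star y * star x ;
  cstar_identity : forall x : A, algnorm (star x * x) = algnorm x ^+ 2 }.

#[short(type="cstarAlgType")]
HB.structure Definition CStarAlgebra (C : numClosedFieldType) :=
  {A of NormedAlgebra_isCStar C A & NormedAlgebra C A}.

HB.instance Definition _ (C : numClosedFieldType) (A : cstarAlgType C) :=
  Uniform_isComplete.Build (normed A) (@cstar_complete C A).

Section BoundedOperators.
Context {C : numClosedFieldType}.

Section OperatorSpace.
Variables X Y : normedModType C.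

Definition bounded_linear (f : X -> Y) : Prop :=
  linear f /\ exists M : C, forall x, `|f x| <= M * `|x|.

Definition bounded_linear_pred : {pred X -> Y} := mem (mkset bounded_linear).

Lemma bounded_linear_submod_closed : submod_closed bounded_linear_pred.
Proof.
split=> [|a f g].
  rewrite inE; split=> [c x y|]; first by rewrite /= scaler0 addr0.
  by exists 0 => x; rewrite mul0r normr0.
rewrite !inE => -[lf [M fM]] [lg [N gN]]; split.
  move=> c x y; rewrite !fctE lf lg !scalerDr !scalerA (mulrC a c).
  by rewrite addrACA.
exists (`|a| * M + N) => x; rewrite !fctE mulrDl -mulrA.
apply: (le_trans (ler_normD _ _)); rewrite lerD//.
by rewrite normrZ ler_wpM2l.
Qed.

HB.instance Definition _ := GRing.isSubmodClosed.Build C _ bounded_linear_pred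
  bounded_linear_submod_closed.

(* the space L(X, Y) *)
Record bounded_op := BoundedOp
  { bounded_op_fun :> X -> Y ; _ : bounded_op_fun \in bounded_linear_pred }.

HB.instance Definition _ := [isSub for bounded_op_fun].
HB.instance Definition _ := [Choice of bounded_op by <:].
HB.instance Definition _ := [SubChoice_isSubLmodule of bounded_op by <:].

End OperatorSpace.

(* an n x m matrix of operators, seen as an operator X^m -> Y^n *)
Definition mxop (X Y : normedModType C) n m
    (T : 'M[bounded_op X Y]_(n, m)) (x : 'cV[X]_m) : 'cV[Y]_n :=
  \col_i \sum_j T i j (x j 0).

(* the inner product of the Hilbert space Y^n *)
Definition cdot (Y : hilbertType C) n (x y : 'cV[Y]_n) : C :=
  \sum_i hdot (x i 0) (y i 0).

(* By the Riesz representation theorem, the set below is a singleton; the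
   value 0 is only the default needed by [xget]. *)
Definition adjoint (X Y : hilbertType C) (T : bounded_op X Y) :
    bounded_op Y X :=
  xget 0 [set T' : bounded_op Y X |
          forall x y, hdot (T x) y = hdot x (T' y)].

Definition adjointmx (X Y : hilbertType C) n m
    (T : 'M[bounded_op X Y]_(n, m)) : 'M[bounded_op Y X]_(m, n) :=
  map_mx (@adjoint X Y) T^T.

(* positivity of an operator on Y^n *)
Definition op_psd (Y : hilbertType C) n (T : 'M[bounded_op Y Y]_n) : Prop :=
  forall y : 'cV[Y]_n, 0 <= cdot (mxop T y) y.

End BoundedOperators.

Section CStarMatrices.
Context {C : numClosedFieldType} {A : cstarAlgType C}.

Definition starmx n m (P : 'M[A]_(n, m)) : 'M[A]_(m, n) := map_mx star P^T.

(* positivity in the algebra of n x n matrices over A, taken as being of the form [starmx B *m B] *)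
Definition cstar_psd n (P : 'M[A]_n) : Prop :=
  exists B : 'M[A]_n, P = starmx B *m B.

Definition unital_star_rep (X : hilbertType C)
    (sigma : {linear A -> bounded_op X X}) : Prop :=
  [/\ sigma 1 = id :> (X -> X),
      forall a b, sigma (a * b) = sigma a \o sigma b :> (X -> X) &
      forall a, sigma (star a) = adjoint (sigma a)].

End CStarMatrices.

Section ScalarMatrices.
Context {C : numClosedFieldType} {V : lmodType C}.

(* products of a scalar matrix with a matrix over a vector space *)
Definition lmulmx p n m (alpha : 'M[C]_(p, n)) (Z : 'M[V]_(n, m)) :
    'M[V]_(p, m) :=
  \matrix_(i, j) \sum_k alpha i k *: Z k j.

Definition rmulmx n m q (Z : 'M[V]_(n, m)) (beta : 'M[C]_(m, q)) :
    'M[V]_(n, q) :=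
  \matrix_(i, j) \sum_k beta k j *: Z i k.

Definition ctrmx n m (beta : 'M[C]_(n, m)) : 'M[C]_(m, n) :=
  map_mx (@Num.conj C) beta^T.

End ScalarMatrices.

(* A subset of S_nc is given by its graded pieces [Omega n : set 'M[S]_n],
   and [Omega n] is also used as the type of its elements.  The element [z : S]
   fills the off-diagonal blocks of direct sums: it is the formal zero when S
   is a set (to which the formal zero has been adjoined), and the actual zero
   when S is a vector space. *)
Section NC.
Variables (S : Type) (z : S).

Definition dsum n m (Z : 'M[S]_n) (W : 'M[S]_m) : 'M[S]_(n + m) :=
  block_mx Z (const_mx z) (const_mx z) W.

(* the first clause says that only matrices of size n >= 1 are considered *)
Definition nc_set (Omega : forall n, set 'M[S]_n) : Prop :=
  Omega 0%N = set0 /\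
  forall n m (Z : 'M[S]_n) (W : 'M[S]_m),
    Omega n Z -> Omega m W -> Omega (n + m)%N (dsum Z W).

End NC.

(* graded functions from Omega to T_nc *)
Definition graded_fun (S : Type) (Omega : forall n, set 'M[S]_n) (T : Type) :=
  forall n, Omega n -> 'M[T]_n.

Definition global_fun (C : numClosedFieldType) (S : Type) (z : S)
    (Omega : forall n, set 'M[S]_n) (T : lmodType C)
    (f : graded_fun Omega T) : Prop :=
  forall n m (Z : Omega n) (W : Omega m) (D : Omega (n + m)%N),
    val D = dsum z (val Z) (val W) ->
    f _ D = block_mx (f _ Z) 0 0 (f _ W).

Definition nc_fun (C : numClosedFieldType) (V : lmodType C)
    (Omega : forall n, set 'M[V]_n) (T : lmodType C)
    (f : graded_fun Omega T) : Prop :=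
  forall n m (Z : Omega n) (Z' : Omega m) (alpha : 'M[C]_(m, n)),
    lmulmx alpha (val Z) = rmulmx (val Z') alpha ->
    lmulmx alpha (f _ Z) = rmulmx (f _ Z') alpha.

Section Kernels.
Context {C : numClosedFieldType} {A : cstarAlgType C} {Y : hilbertType C}.

Definition kernel_fun (S : Type) (Omega : forall n, set 'M[S]_n) :=
  forall n m, Omega n -> Omega m ->
    'M[A]_(n, m) -> 'M[bounded_op Y Y]_(n, m).

Definition graded_kernel (S : Type) (Omega : forall n, set 'M[S]_n)
    (K : kernel_fun Omega) : Prop :=
  forall n m (Z : Omega n) (W : Omega m) (c : C) (P Q : 'M[A]_(n, m)),
    K _ _ Z W (map_mx ( *:%R c) P + Q) =
    map_mx ( *:%R c) (K _ _ Z W P) + K _ _ Z W Q.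

Definition global_kernel (S : Type) (z : S) (Omega : forall n, set 'M[S]_n)
    (K : kernel_fun Omega) : Prop :=
  graded_kernel K /\
  forall n n' m m' (Z : Omega n) (Z' : Omega n') (D : Omega (n + n')%N)
      (W : Omega m) (W' : Omega m') (E : Omega (m + m')%N),
    val D = dsum z (val Z) (val Z') -> val E = dsum z (val W) (val W') ->
    forall (P11 : 'M[A]_(n, m)) (P12 : 'M[A]_(n, m'))
           (P21 : 'M[A]_(n', m)) (P22 : 'M[A]_(n', m')),
    K _ _ D E (block_mx P11 P12 P21 P22) =
    block_mx (K _ _ Z W P11) (K _ _ Z W' P12)
             (K _ _ Z' W P21) (K _ _ Z' W' P22).

Definition nc_kernel (V : lmodType C) (Omega : forall n, set 'M[V]_n)
    (K : kernel_fun Omega) : Prop :=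
  graded_kernel K /\
  forall n n' m m' (Z : Omega n) (Z' : Omega n') (alpha : 'M[C]_(n', n))
      (W : Omega m) (W' : Omega m') (beta : 'M[C]_(m', m)) (P : 'M[A]_(n, m)),
    lmulmx alpha (val Z) = rmulmx (val Z') alpha ->
    lmulmx beta (val W) = rmulmx (val W') beta ->
    rmulmx (lmulmx alpha (K _ _ Z W P)) (ctrmx beta) =
    K _ _ Z' W' (rmulmx (lmulmx alpha P) (ctrmx beta)).

Definition cp_kernel (S : Type) (Omega : forall n, set 'M[S]_n)
    (K : kernel_fun Omega) : Prop :=
  forall n (Z : Omega n) (P : 'M[A]_n), cstar_psd P -> op_psd (K _ _ Z Z P).

(* The class [F] of functions is [global_fun z] or [nc_fun]. The elements of
   the Hilbert space [HK] are identified with functions through the injection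
   [ev], for which the vector space operations of [HK] are pointwise;
   [k W v y] is the element K_{W,v,y} of [HK]. *)
Definition has_rkhs (S : Type) (Omega : forall n, set 'M[S]_n)
    (F : forall T : lmodType C, graded_fun Omega T -> Prop)
    (K : kernel_fun Omega) : Prop :=
  exists (HK : hilbertType C)
         (ev : HK -> graded_fun Omega (bounded_op (normed A) Y))
         (k : forall m, Omega m -> 'rV[A]_m -> 'cV[Y]_m -> HK)
         (sigma : {linear A -> bounded_op HK HK}),
  [/\ injective ev,
      forall (c : C) (f g : HK) n (Z : Omega n),
        ev (c *: f + g) _ Z = map_mx ( *:%R c) (ev f _ Z) + ev g _ Z &
      forall f : HK, F _ (ev f)] /\
  [/\ forall m (W : Omega m) v y n (Z : Omega n) (u : 'cV[A]_n),
        mxop (ev (k _ W v y) _ Z) u = mxop (K _ _ Z W (u *m v)) y,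
      forall (f : HK) m (W : Omega m) v y,
        cdot (mxop (ev f _ W) (starmx v)) y = hdot f (k _ W v y) &
      [/\ unital_star_rep sigma,
          forall (a : A) (f : HK) m (W : Omega m) (v : 'rV[A]_m),
            mxop (ev (sigma a f) _ W) (starmx v) =
            mxop (ev f _ W) (starmx v *m a%:M) &
          forall (a : A) m (W : Omega m) v y,
            sigma a (k _ W v y) = k _ W (a%:M *m v) y]].

Definition has_kolmogorov (S : Type) (Omega : forall n, set 'M[S]_n)
    (F : forall T : lmodType C, graded_fun Omega T -> Prop)
    (K : kernel_fun Omega) : Prop :=
  exists (X : hilbertType C) (sigma : {linear A -> bounded_op X X})
         (H : graded_fun Omega (bounded_op X Y)),
  [/\ unital_star_rep sigma, F _ H &
      forall n m (Z : Omega n) (W : Omega m) (P : 'M[A]_(n, m)),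
        mxop (K _ _ Z W P) =
        mxop (H _ Z) \o mxop (map_mx sigma P) \o mxop (adjointmx (H _ W))].

End Kernels.

Arguments kernel_fun {C} A Y {S} Omega.
Arguments global_fun {C S} z {Omega} T f.
Arguments nc_fun {C V Omega} T f.

(* Main.v *)
(** (1) => (2): direct sums in Omega make the functions K_{W,v,y} a vector space,
    on which <K_{W,v,y}, K_{Z,u,x}> = <K(Z,W)(u^* v) y, x> is positive
    semidefinite.  H(K) is its completion, realized as the set of the functionals
    on indices (W,v,y) that are limits of sections of this Gram kernel; the values
    f(W) are recovered by Riesz' theorem, and (sigma(a) f)(W,v,y) = f(W,a^* v,y).
    This is bounded because 2|a|^2 - a^* a = b^* b for some b in A.
    (2) => (3): X = H(K) and H(Z) f = f(Z) 1, whose adjoint maps y to the column of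
    the K_{Z,e_j,y}.
    (3) => (1): a direct computation. *)

(* The global hypothesis on K splits both arguments at once, while adding sections of the Gram
   kernel needs a splitting of one argument with the other held fixed; this is extracted from the
   associativity of direct sums. Hermitian symmetry of the Gram kernel is not assumed either: it
   comes by polarization from positivity at direct sums. Since the functions K_{W,v,y} themselves
   form a vector space, norm estimates can be tested at a single index, and neither finite linear
   combinations nor a quotient by null vectors occur. The class of functions does not enter the
   construction of H(K): by (b), an identity for all f follows from one between kernel elements,
   which is then read off K. The nc case therefore uses the same space as the global case. The 2 in
   2|a|^2 gives a^* a / (2|a|^2) norm 1/2 for nonzero a, small enough for a square root of 1 minus
   it to be found by a contraction, without spectral theory. *)
Require Import Defs.
From HB Require Import structures.
From mathcomp Require Import all_boot all_order all_algebra complex.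
From mathcomp Require Import all_classical all_reals.
From mathcomp Require Import topology normedtype ring lra.

Set Implicit Arguments.
Unset Strict Implicit.
Unset Printing Implicit Defensive.

Import Order.TTheory GRing.Theory Num.Theory.
Import numFieldNormedType.Exports.

Local Open Scope classical_set_scope.
Local Open Scope ring_scope.

(** * Completeness and inner products *)

Section Approximation.

Lemma dist_small_eq (K : numFieldType) (V : normedZmodType K) (M : K) (x y : V) :
  0 <= M -> (forall e : K, 0 < e -> `|x - y| <= M * e) -> x = y.
Proof.
move=> M0 small; apply/eqP; rewrite -subr_eq0 -normr_le0; apply/ler_addgt0Pr => e e0.
have M1 : 0 < M + 1 by rewrite ltr_wpDl.
rewrite add0r (le_trans (small (e / (M + 1)) _)) ?divr_gt0// mulrCA ger_pMr//.
by rewrite ler_pdivrMr// mul1r lerDl ler01.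
Qed.

(* [B e x] reads "x is within e of the point to be found". *)
Definition approximations (K : numFieldType) (V : normedZmodType K)
    (B : K -> V -> Prop) :=
  (forall e : K, 0 < e -> exists x, B e x) /\
  (forall (e e' : K) x x', 0 < e -> 0 < e' -> B e x -> B e' x' -> `|x - x'| <= e + e').

(** Completeness without sequences: the approximations of small error generate a Cauchy filter.
    Comparing a fixed [x] with ever finer approximations costs [e + c] with [c] as small as desired,
    so the limit satisfies the bound [e] without loss. *)
Lemma approximations_complete (K : numFieldType) (V : completeNormedModType K)
    (B : K -> V -> Prop) :
  approximations B ->
  exists z, forall (e : K) x, 0 < e -> B e x -> `|z - x| <= e.
Proof.
move=> [Bex Bdist].
pose F : set_system V :=
  [set U | exists2 e, 0 < e & forall e' x, 0 < e' -> e' <= e -> B e' x -> U x].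
have FF : ProperFilter F.
  split.
    by move=> [e e0 /(_ e)]; have [x Bx] := Bex e e0 => /(_ x e0 (lexx _) Bx).
  split.
  - by exists 1.
  - move=> P Q [e e0 PP] [e' e'0 QQ].
    have [le|/ltW le] := real_leP (gtr0_real e0) (gtr0_real e'0).
    + exists e => // d x d0 de Bx; split; first exact: PP Bx.
      exact: QQ (le_trans de le) Bx.
    + exists e' => // d x d0 de Bx; split; last exact: QQ Bx.
      exact: PP (le_trans de le) Bx.
  - move=> P Q PQ [e e0 PP]; exists e => // e' x e'0 le Bx; exact/PQ/(PP e').
have Fc : cvg F.
  apply: cauchy_cvg; apply/cauchyP => e e0.
  have e3 : 0 < e / 3 by rewrite divr_gt0.
  have [x Bx] := Bex _ e3; exists x, (e / 3) => // e' x' e'0 le Bx'.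
  rewrite -ball_normE /ball_/=; apply: le_lt_trans (Bdist _ _ _ _ e3 e'0 Bx Bx') _.
  rewrite (le_lt_trans (lerD (lexx _) le))// [ltRHS](_ : e = e / 3 + e / 3 + e / 3).
    by rewrite ltrDl.
  by field.
exists (lim F) => e x e0 Bx; apply/ler_addgt0Pr => d d0.
have d2 : 0 < d / 2 by rewrite divr_gt0.
have [d' d'0 Bd'] := (fcvg_ballP _).1 Fc _ d2.
(* A positive number below both [d'] and [d / 2], in place of a minimum. *)
pose c := d' * (d / 2) / (d' + d / 2).
have s0 : 0 < d' + d / 2 by rewrite addr_gt0.
have c0 : 0 < c by rewrite divr_gt0// mulr_gt0.
have cd' : c <= d' by rewrite ler_pdivrMr// ler_wpM2l ?ltW// ltrDr.
have cd : c <= d / 2.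
  by rewrite ler_pdivrMr// mulrC ler_wpM2l ?(ltW d2)// lerDl ltW.
have [x' Bx'] := Bex c c0.
have := Bd' _ _ c0 cd' Bx'; rewrite -ball_normE /ball_/= => /ltW zx'.
rewrite (le_trans (ler_distD x' _ _))//.
rewrite (le_trans (lerD zx' (Bdist _ _ _ _ c0 e0 Bx' Bx)))//.
by rewrite addrA addrC lerD2l [leRHS]splitr lerD2l.
Qed.

(** Real and imaginary parts are treated separately, each limit being the supremum of the lower
    estimates [f x - Re e]; [f] only has to be 1-Lipschitz. *)
Lemma complex_approximations_complete (R : realType) (B : R[i] -> R[i] -> Prop) :
  approximations B ->
  exists z, forall (e : R[i]) x, 0 < e -> B e x -> `|z - x| <= e.
Proof.
move=> [Bex Bdist].
have real_lim (f : R[i] -> R) : (forall x y, `|f x - f y|%:C%C <= `|x - y|) ->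
    exists z, forall (e : R[i]) x, 0 < e -> B e x -> `|z - f x|%:C%C <= e.
  move=> f_contr.
  pose S := [set r | exists e x, [/\ 0 < e, B e x & r = f x - complex.Re e]].
  have SB e x : 0 < e -> B e x -> ubound S (f x + complex.Re e).
    move=> e0 Bx _ [e' [x' [e'0 Bx' ->]]].
    have := le_trans (f_contr x' x) (Bdist _ _ _ _ e'0 e0 Bx' Bx).
    rewrite lecE => /andP[_ /=]; rewrite raddfD/= => /(le_trans (ler_norm _)).
    by move=> ?; lra.
  have [x1 Bx1] := Bex 1 ltr01.
  have S0 : S !=set0 by exists (f x1 - complex.Re 1), 1, x1.
  exists (sup S) => e x e0 Bx.
  have -> : e = (complex.Re e)%:C%C by rewrite RRe_real// gtr0_real.
  have le1 : sup S <= f x + complex.Re e by exact/(ge_sup S0)/SB.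
  have le2 : f x - complex.Re e <= sup S.
    by apply: ub_le_sup; [exists (f x + complex.Re e); exact: SB|exists e, x].
  by rewrite lecR ler_norml; apply/andP; split; lra.
have [] := real_lim (@complex.Re R).
  by move=> x y; rewrite -raddfB; exact: normc_ge_Re.
move=> a Ba; have [] := real_lim (@complex.Im R).
  move=> x y; rewrite -raddfB/=.
  have := normc_ge_Re ((x - y) * 'i%C); rewrite ReiNIm normrN normrM.
  by rewrite [`|'i%C|]normc_def/= expr0n/= expr1n add0r sqrtr1 mulr1.
move=> b Bb; pose z := (a +i* b)%C; exists z => e x e0 Bx.
have crude d y : 0 < d -> B d y -> `|z - y| <= 2 * d.
  move=> d0 By; rewrite [z - y]complexE (le_trans (ler_normD _ _))// normrM.
  rewrite [`|'i%C|]normc_def/= expr0n/= expr1n add0r sqrtr1 mul1r.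
  rewrite mulr_natl mulr2n lerD// normc_def/= expr0n/= addr0 sqrtr_sqr.
  - by case: y By => u v /= /(Ba _ _ d0).
  - by case: y By => u v /= /(Bb _ _ d0).
(* Recombining the two parts by the triangle inequality loses a factor 2 ([crude]); going through a
   much finer approximation [y] recovers the exact constant. *)
apply/ler_addgt0Pr => d d0; have d3 : 0 < d / 3 by rewrite divr_gt0.
have [y By] := Bex _ d3.
rewrite (le_trans (ler_distD y _ _))//.
rewrite (le_trans (lerD (crude _ _ d3 By) (Bdist _ _ _ _ d3 e0 By Bx)))//.
by rewrite [leRHS](_ : _ = 2 * (d / 3) + (d / 3 + e))//; field.
Qed.

End Approximation.

Section Dot.
Context {C : numClosedFieldType} {X : hilbertType C}.
Implicit Types (x y w : X) (c : C).

Lemma hdotDl x y w : hdot (x + y) w = hdot x w + hdot y w.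
Proof. exact: linearDl. Qed.

Lemma hdotZl c x w : hdot (c *: x) w = c * hdot x w.
Proof. exact: linearZl_LR. Qed.

Lemma hdotDr w x y : hdot w (x + y) = hdot w x + hdot w y.
Proof. exact: linearDr. Qed.

Lemma hdotZr c w x : hdot w (c *: x) = c^* * hdot w x.
Proof. exact: linearZr_LR. Qed.

Lemma hdotC x y : hdot x y = (hdot y x)^*.
Proof. by rewrite hermC expr0 mul1r. Qed.

Lemma hdot0l x : hdot 0 x = 0. Proof. exact: linear0l. Qed.

Lemma hdot0r x : hdot x 0 = 0. Proof. exact: linear0r. Qed.

Lemma hdotBl x y w : hdot (x - y) w = hdot x w - hdot y w.
Proof. exact: linearBl. Qed.

Lemma hdotBr w x y : hdot w (x - y) = hdot w x - hdot w y.
Proof. exact: linearBr. Qed.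

Lemma hdot_suml (I : Type) (r : seq I) (P : pred I) (F : I -> X) w :
  hdot (\sum_(i <- r | P i) F i) w = \sum_(i <- r | P i) hdot (F i) w.
Proof. exact: linear_sumlz. Qed.

Lemma hdot_sumr (I : Type) (r : seq I) (P : pred I) (F : I -> X) w :
  hdot w (\sum_(i <- r | P i) F i) = \sum_(i <- r | P i) hdot w (F i).
Proof. exact: linear_sumr. Qed.

Lemma hdot_ge0 x : 0 <= hdot x x.
Proof. exact: dnorm_ge0. Qed.

Lemma hdot_inj x y : (forall w, hdot w x = hdot w y) -> x = y.
Proof.
move=> xy; apply/eqP; rewrite -subr_eq0 -(dnorm_eq0 hdot) hdotBr.
by rewrite xy subrr.
Qed.

Lemma hdot_injl x y : (forall w, hdot x w = hdot y w) -> x = y.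
Proof. by move=> xy; apply: hdot_inj => w; rewrite hdotC xy -hdotC. Qed.

End Dot.

(** * Gram kernels and the Cauchy-Schwarz inequality *)

Section GramMatrix.
Variables (C : numClosedFieldType) (I : Type).

(* A positive semidefinite kernel whose sections [G^~ i] already form a vector
   space: linear combinations of sections need not be considered. *)
Record is_gram (G : I -> I -> C) : Prop := IsGram {
  gram_herm : forall i j, G i j = (G j i)^* ;
  gram_ge0 : forall i, 0 <= G i i ;
  gram_lin : forall c i j, exists k, forall l, G l k = c * G l i + G l j }.

(** Discriminant argument in a real variable [t]: for the section [k] given by [- t * G i j] times
    [i] plus [j], the number [G k k] is a nonnegative quadratic polynomial in [t]. It is evaluated
    at its minimizer [1 / G i i] or, if [G i i = 0], where the then affine polynomial would be
    negative. *)
Lemma gram_CauchySchwarz (G : I -> I -> C) i j : is_gram G ->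
  `|G i j| <= sqrtC (G i i) * sqrtC (G j j).
Proof.
move=> [herm ge0 lin].
have quad t : t^* = t ->
    0 <= t ^+ 2 * `|G i j| ^+ 2 * G i i - 2 * t * `|G i j| ^+ 2 + G j j.
  move=> tR; have [k Hk] := lin (- t * G i j) i j.
  suff <- : G k k = t ^+ 2 * `|G i j| ^+ 2 * G i i - 2 * t * `|G i j| ^+ 2 + G j j.
    exact: ge0.
  rewrite Hk (herm k i) (herm k j) !Hk !rmorphD !rmorphM rmorphN/= tR -!herm.
  by rewrite (herm j i) normCK; ring.
have aR : (G i i)^* = G i i by rewrite -herm.
have dR : (G j j)^* = G j j by rewrite -herm.
suff : `|G i j| ^+ 2 <= G i i * G j j.
  rewrite -sqrtCM ?nnegrE// => CS.
  by rewrite -(sqrCK (normr_ge0 (G i j))) ler_sqrtC ?nnegrE ?mulr_ge0 ?exprn_ge0.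
have [a0|a0] := eqVneq (G i i) 0.
  suff -> : G i j = 0 by rewrite normr0 expr0n a0 mul0r.
  apply/eqP/negPn/negP => b0.
  have nb0 : `|G i j| ^+ 2 != 0 by rewrite expf_neq0// normr_eq0.
  (* For this [t] the affine polynomial takes the value [- (G j j + 2)]. *)
  have := quad ((G j j + 1) / `|G i j| ^+ 2).
  rewrite a0 mulr0 add0r -mulrA divfK//.
  rewrite rmorphM fmorphV rmorphD rmorph1 rmorphXn/= conj_normC dR => /(_ erefl).
  rewrite [X in 0 <= X](_ : _ = - (G j j + 2)); last by ring.
  by rewrite oppr_ge0 real_leNgt ?ger0_real ?addr_ge0// ltr_wpDl.
have := quad (G i i)^-1; rewrite fmorphV/= aR => /(_ erefl).
rewrite [X in 0 <= X](_ : _ = G j j - `|G i j| ^+ 2 / G i i); last by field.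
by rewrite subr_ge0 ler_pdivrMr 1?lt_def ?a0 ?ge0// mulrC.
Qed.

End GramMatrix.

Section DotNorm.
Context {C : numClosedFieldType} {X : hilbertType C}.
Implicit Types x y : X.

Lemma hnormE x : `|x| = sqrtC (hdot x x).
Proof. by rewrite -hdot_norm sqrCK. Qed.

Lemma hdot_CauchySchwarz x y : `|hdot x y| <= `|x| * `|y|.
Proof.
rewrite mulrC !hnormE.
apply: (@gram_CauchySchwarz C X (fun i j => hdot j i)).
split=> [i j|i|c i j]; [exact: hdotC|exact: hdot_ge0|].
by exists (c *: i + j) => l; rewrite hdotDl hdotZl.
Qed.

Lemma hnorm_le x M : 0 <= M -> (forall y, `|hdot x y| <= M * `|y|) -> `|x| <= M.
Proof.
move=> M0 xM; have [->|x0] := eqVneq x 0; first by rewrite normr0.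
have := xM x; rewrite -hdot_norm normrX normr_id expr2.
by rewrite ler_pM2r ?normr_gt0.
Qed.

End DotNorm.

Section Riesz.
Context {R : realType} {X : hilbertType R[i]}.

(* The minimizing sequences of [`|x|^2 - 2 Re (phi x)] are Cauchy by the
   parallelogram identity, and at their limit the derivative vanishes. *)
Lemma Riesz_representation (phi : X -> R[i]) (M : R[i]) :
  (forall c x y, phi (c *: x + y) = c * phi x + phi y) ->
  (forall x, `|phi x| <= M * `|x|) ->
  exists z, forall x, phi x = hdot x z.
Proof.
move=> phi_lin phi_bnd.
(* [M] is forced to be nonnegative only if [X] has a nonzero vector; [b] is a positive bound in
   every case. *)
pose b : R[i] := `|M| + 1.
have b0 : 0 < b by rewrite ltr_wpDl.
have phib x : `|phi x| <= b * `|x|.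
  rewrite (le_trans (phi_bnd x))//; have [->|x0] := eqVneq x 0.
    by rewrite normr0 !mulr0.
  have Mr : M \is Num.real.
    have := le_trans (normr_ge0 _) (phi_bnd x).
    by rewrite pmulr_lge0 ?normr_gt0// => /ger0_real.
  by rewrite ler_wpM2r// (le_trans (real_ler_norm Mr))// lerDl ler01.
have phi0 : phi 0 = 0.
  by have := phi_lin (-1) 0 0; rewrite scaler0 addr0 mulN1r addNr.
have phiZ c x : phi (c *: x) = c * phi x.
  by have := phi_lin c x 0; rewrite !addr0 phi0 addr0.
have phiD x y : phi (x + y) = phi x + phi y.
  by have := phi_lin 1 x y; rewrite scale1r mul1r.
pose J (x : X) : R[i] := hdot x x - (phi x + (phi x)^*).
have JR x : J x = (complex.Re (J x))%:C%C.
  rewrite RRe_real//; apply: rpredB; first exact/ger0_real/hdot_ge0.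
  by apply/CrealP; rewrite rmorphD/= conjCK addrC.
(* Completing the square: [J x] is at least [|x|^2 - 2 b |x|], which exceeds the left side by
   [(|x| - b)^2]. *)
have Jge x : - b ^+ 2 <= J x.
  rewrite -subr_ge0 opprK; apply: (@le_trans _ _ ((`|x| - b) ^+ 2)).
    by rewrite real_exprn_even_ge0// rpredB ?ger0_real ?(ltW b0).
  rewrite sqrrB hdot_norm /J -subr_ge0.
  rewrite [X in 0 <= X](_ : _ = b * `|x| + b * `|x| - (phi x + (phi x)^*)); last by ring.
  rewrite subr_ge0.
  apply: le_trans (real_ler_norm _) _.
    by apply/CrealP; rewrite rmorphD/= conjCK addrC.
  by rewrite (le_trans (ler_normD _ _))// lerD// ?norm_conjC phib.
pose S := [set complex.Re (J x) | x in [set: X]].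
have Sinf : has_inf S.
  split; first by exists (complex.Re (J 0)), 0.
  exists (- complex.Re b ^+ 2) => _ [x _ <-].
  have := Jge x; rewrite -[b in b ^+ 2]RRe_real ?gtr0_real//.
  by rewrite -rmorphXn -rmorphN JR lecR.
pose m : R[i] := (inf S)%:C%C.
have mJ x : m <= J x by rewrite JR lecR; apply: ge_inf; [exact: Sinf.2|exists x].
have quadJ t x y : J (x + t *: y) =
    J x + (`|t| ^+ 2 * hdot y y + (t * (hdot y x - phi y) + (t * (hdot y x - phi y))^*)).
  rewrite /J phiD phiZ hdotDl !hdotDr !hdotZl !hdotZr (hdotC x y) normCK.
  by rewrite !rmorphD !rmorphM rmorphB/=; ring.
(* The parallelogram identity bounds [|x - x'|^2] by [e^2 + e'^2] for two such points, hence by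
   [(e + e')^2]. *)
pose B (e : R[i]) x := J x <= m + e ^+ 2 / 2.
have Bapp : approximations B.
  split=> [e e0|e e' x x' e0 e'0 Bx Bx'].
    have e2 : 0 < complex.Re e ^+ 2 / 2.
      by rewrite divr_gt0// exprn_gt0//; move: e0; rewrite ltcE => /andP[].
    have [_ [x _ <-] /ltW] := inf_adherent e2 Sinf; exists x; rewrite /B JR /m.
    rewrite -[e in X in _ <= X]RRe_real ?gtr0_real//.
    by rewrite -rmorphXn -(rmorph_nat (real_complex R)) -fmorphV -rmorphM -rmorphD lecR.
  rewrite -ler_sqr ?nnegrE ?addr_ge0 ?(ltW e0) ?(ltW e'0)// hdot_norm.
  have par : hdot (x - x') (x - x') = 2 * J x + 2 * J x' - 4 * J (2^-1 *: (x + x')).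
    rewrite /J phiZ phiD hdotZl hdotZr !hdotBl !hdotBr !hdotDl !hdotDr.
    rewrite fmorphV rmorph_nat rmorphM fmorphV rmorph_nat rmorphD/=.
    by field.
  rewrite par; apply: (@le_trans _ _ (2 * (m + e ^+ 2 / 2) + 2 * (m + e' ^+ 2 / 2) - 4 * m)).
    by rewrite lerD ?lerN2 ?lerD ?ler_pM2l.
  rewrite [leLHS](_ : _ = e ^+ 2 + e' ^+ 2); last by field.
  rewrite sqrrD addrAC lerDl mulrn_wge0// mulr_ge0// ltW//.
have [z zB] := approximations_complete Bapp.
exists z => y; pose K : R[i] := hdot y y + 1.
have K0 : 0 < K by rewrite ltr_wpDl ?hdot_ge0.
have K1 : 1 <= K by rewrite lerDr hdot_ge0.
apply: (@dist_small_eq _ R[i] (K + `|y|)) => [|e e0]; first by rewrite addr_ge0// (ltW K0).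
have [x Bx] := Bapp.1 e e0.
rewrite (le_trans (ler_distD (hdot y x) _ _))// mulrDl lerD//; last first.
  rewrite -hdotBr (le_trans (hdot_CauchySchwarz _ _))// ler_wpM2l//.
  by rewrite distrC zB.
rewrite distrC; set d : R[i] := hdot y x - phi y.
(* The derivative [d] is bounded at the near-minimizer [x] rather than at the limit. This move along
   [y] lowers [J] by at least [|d|^2 / K], while [J] can drop by at most [e^2 / 2]; the 1 in [K]
   keeps the division legitimate for [y = 0]. *)
have := le_trans Bx (lerD (mJ (x + (- d^* / K) *: y)) (lexx _)).
rewrite quadJ -/d -addrA lerDl.
have KR : K^* = K by rewrite conj_Creal// gtr0_real.
have -> : (- d^* / K * d + (- d^* / K * d)^*) = - (2 * `|d| ^+ 2 / K).
  by rewrite normCK !rmorphM rmorphN fmorphV/= conjCK KR; ring.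
rewrite normrM normrN norm_conjC normfV (gtr0_norm K0) => le1.
have le2 : `|d| ^+ 2 / K <= e ^+ 2 / 2.
  rewrite -subr_ge0 (le_trans le1)// -subr_ge0.
  rewrite [X in 0 <= X](_ : _ = `|d| ^+ 2 / K ^+ 2); last first.
    have yK : hdot y y = K - 1 by rewrite addrK.
    by rewrite yK; clearbody K d; field; rewrite gt_eqF.
  by rewrite divr_ge0// exprn_ge0// ltW.
rewrite -ler_sqr ?nnegrE ?mulr_ge0 ?(ltW e0) ?(ltW K0)// exprMn.
move: le2; rewrite ler_pdivrMr// => /le_trans; apply.
rewrite [K ^+ 2]expr2 [leRHS]mulrC mulrA ler_wpM2r ?(ltW K0)// mulrC.
by rewrite [leLHS]mulrC ler_wpM2r ?exprn_ge0 ?(ltW e0)// (le_trans _ K1)// invf_le1 ?ler1n.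
Qed.

End Riesz.

(** * Hilbert spaces with a reproducing kernel *)

(** The distinguished index makes the zero function approximable: the difference of its section with
    itself is again a section. *)
Record gram (R : realType) := Gram {
  gram_index : Type ;
  gram_fun :> gram_index -> gram_index -> R[i] ;
  gramP : is_gram gram_fun ;
  gram_point : gram_index }.

Section RKHS.
Variables (R : realType) (G : gram R).
Local Notation C := (R[i]).
Local Notation I := (gram_index G).
Implicit Types (F : I -> C) (i j k l : I) (c e M N : C).

Definition gram_norm i : C := sqrtC (G i i).

(* [M] bounds the norm of [F] as a functional on the span of the sections. *)
Definition gram_bounded M F := forall l, `|F l| <= M * gram_norm l.

Definition gram_close e F i := gram_bounded e (fun l => F l - G l i).

Definition approximable F := forall e, 0 < e -> exists i, gram_close e F i.

Lemma gram_norm_ge0 i : 0 <= gram_norm i.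
Proof. by rewrite sqrtC_ge0 (gram_ge0 (gramP G)). Qed.

Lemma gram_normK i : gram_norm i ^+ 2 = G i i.
Proof. exact: sqrtCK. Qed.

Lemma gram_sub i j : exists k, forall l, G l k = G l i - G l j.
Proof.
have [k Hk] := gram_lin (gramP G) (-1) j i.
by exists k => l; rewrite Hk mulN1r addrC.
Qed.

Lemma gram_bounded_le M N F : M <= N -> gram_bounded M F -> gram_bounded N F.
Proof.
move=> MN MF l; apply: le_trans (MF l) _.
by rewrite ler_wpM2r ?gram_norm_ge0.
Qed.

Lemma gram_bounded_lin c M N F F' : gram_bounded M F -> gram_bounded N F' ->
  gram_bounded (`|c| * M + N) (fun l => c * F l + F' l).
Proof.
move=> MF NF' l; apply: le_trans (ler_normD _ _) _.
by rewrite mulrDl lerD// normrM -mulrA ler_wpM2l.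
Qed.

Lemma gram_bounded_gram i : gram_bounded (gram_norm i) (G^~ i).
Proof. by move=> l; rewrite mulrC; exact: gram_CauchySchwarz (gramP G). Qed.

Lemma gram_close_gram e i : 0 <= e -> gram_close e (G^~ i) i.
Proof. by move=> e0 l; rewrite subrr normr0 mulr_ge0 ?gram_norm_ge0. Qed.

(** Both estimates are tested at the index [k] itself, which gives [|k|^2 = G k k <= (e + e') |k|].
    The same device bounds the norm of a section close to a given function. *)
Lemma gram_close_dist F e e' i j k : gram_close e F i -> gram_close e' F j ->
  0 <= e -> 0 <= e' -> (forall l, G l k = G l i - G l j) -> gram_norm k <= e + e'.
Proof.
move=> Fi Fj e0 e'0 Hk; have [->|k0] := eqVneq (gram_norm k) 0.
  by rewrite addr_ge0.
have : gram_norm k ^+ 2 <= (e + e') * gram_norm k.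
  rewrite -[leLHS]ger0_norm ?exprn_ge0 ?gram_norm_ge0// gram_normK Hk.
  apply: le_trans (ler_distD (F k) _ _) _; rewrite [leRHS]mulrDl.
  by apply: lerD; [rewrite distrC; exact: (Fi k)|exact: (Fj k)].
by rewrite expr2 ler_pM2r// lt_def k0 gram_norm_ge0.
Qed.

Definition rkhs_pred : {pred I -> C^o} := mem (mkset approximable).

Lemma rkhs_submod_closed : submod_closed rkhs_pred.
Proof.
split=> [|a f g].
  rewrite inE => e e0; have [k Hk] := gram_sub (gram_point G) (gram_point G).
  exists k => l; rewrite Hk subrr subr0 normr0.
  by rewrite mulr_ge0 ?gram_norm_ge0 ?(ltW e0).
rewrite !inE => fa ga e e0.
have a1 : 0 < `|a| + 1 by rewrite ltr_wpDl.
have e1 : 0 < e / 2 / (`|a| + 1) by rewrite !divr_gt0.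
have e2 : 0 < e / 2 by rewrite divr_gt0.
have [i fi] := fa _ e1; have [j gj] := ga _ e2.
have [k Hk] := gram_lin (gramP G) a i j; exists k => l.
rewrite [X in `|X|](_ : _ = a * (f l - G l i) + (g l - G l j)); last first.
  by rewrite Hk -[LHS]/(a * f l + g l - _); ring.
apply: (gram_bounded_le _ (gram_bounded_lin a fi gj)).
rewrite [leRHS]splitr lerD2r mulrCA ger_pMr// ler_pdivrMr// mul1r.
by rewrite lerDl.
Qed.

HB.instance Definition _ := GRing.isSubmodClosed.Build C _ rkhs_pred
  rkhs_submod_closed.

Record rkhs := RKHS { rkhs_fun : I -> C^o ; _ : rkhs_fun \in rkhs_pred }.

HB.instance Definition _ := [isSub for rkhs_fun].
HB.instance Definition _ := [Choice of rkhs by <:].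
HB.instance Definition _ := [SubChoice_isSubLmodule of rkhs by <:].

Definition rkhs_eval (f : rkhs) : I -> C := rkhs_fun f.
Coercion rkhs_eval : rkhs >-> Funclass.

Implicit Types f g h : rkhs.

Lemma rkhs_evalP c f g l : (c *: f + g : rkhs) l = c * f l + g l.
Proof. by []. Qed.

Lemma rkhs_eval0 l : (0 : rkhs) l = 0.
Proof. by []. Qed.

Lemma rkhs_ext f g : f =1 g -> f = g.
Proof. by move=> fg; apply/val_inj/funext. Qed.

Lemma rkhs_approx f e : 0 < e -> exists i, gram_close e f i.
Proof. by case: f => f /=; rewrite inE => /(_ e). Qed.

Lemma rkhs_bounded f : exists2 M, 0 <= M & gram_bounded M f.
Proof.
have [i fi] := rkhs_approx f ltr01; exists (1 + gram_norm i).
  by rewrite addr_ge0 ?gram_norm_ge0.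
move=> l; rewrite -(subrK (G l i) (f l)) (le_trans (ler_normD _ _))//.
by rewrite mulrDl lerD ?gram_bounded_gram//; exact: fi.
Qed.

(** Hermitian symmetry makes sections antilinear in the point of evaluation, and limits of sections
    inherit this. Linear relations between sections thus become relations between the values of
    every [f]. *)
Lemma rkhs_antilinear f c i j k : (forall l, G l k = c * G l i + G l j) ->
  f k = c^* * f i + f j.
Proof.
move=> Hk; have herm := gram_herm (gramP G).
apply: (@dist_small_eq _ R[i] (gram_norm k + `|c| * gram_norm i + gram_norm j)).
  by rewrite !addr_ge0 ?mulr_ge0 ?gram_norm_ge0.
move=> e e0; have [x fx] := rkhs_approx f e0.
have -> : f k - (c^* * f i + f j) =
    (f k - G k x) - c^* * (f i - G i x) - (f j - G j x).
  by rewrite (herm k x) Hk rmorphD rmorphM/= -!herm; ring.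
apply: le_trans (ler_normB _ _) _; rewrite [leRHS]mulrC [leRHS]mulrDr.
apply: lerD; last exact: (fx _).
apply: le_trans (ler_normB _ _) _; rewrite [leRHS]mulrDr.
apply: lerD; first exact: (fx _).
rewrite normrM norm_conjC mulrCA ler_wpM2l//; exact: (fx _).
Qed.

Lemma rkhs_dist f M h e e' i j : 0 <= M -> gram_bounded M f ->
  gram_close e h i -> gram_close e' h j -> 0 <= e -> 0 <= e' ->
  `|f i - f j| <= M * (e + e').
Proof.
move=> M0 fM hi hj e0 e'0; have [k Hk] := gram_sub i j.
have -> : f i - f j = f k.
  rewrite (@rkhs_antilinear f (-1) j i k) => [|l]; last by rewrite Hk mulN1r addrC.
  by rewrite rmorphN rmorph1 mulN1r addrC.
apply: le_trans (fM k) _; rewrite ler_wpM2l//.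
exact: gram_close_dist hi hj e0 e'0 Hk.
Qed.

(** The inner product with a section should be evaluation, so [<f, g>] has to be the limit of [f i]
    over sections [i] tending to [g]. The value 0 is only the default of [xget]: the limit is shown
    to exist in [rkhs_dotP]. *)
Definition rkhs_dot f g : C :=
  xget 0 [set z | exists2 M, 0 <= M &
    forall e i, 0 < e -> gram_close e g i -> `|z - f i| <= M * e].

Lemma rkhs_dotP f g M e i : 0 <= M -> gram_bounded M f -> 0 < e ->
  gram_close e g i -> `|rkhs_dot f g - f i| <= M * e.
Proof.
move=> M0 fM e0 gi; have [N N0 fN] : exists2 N, 0 <= N &
    forall e i, 0 < e -> gram_close e g i -> `|rkhs_dot f g - f i| <= N * e.
  rewrite /rkhs_dot; case: xgetP => [z _ //|].
  (* A functional of norm at most [M] multiplies errors by [M]; dividing the radius by [M + 1]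
     compensates for this and is safe for [M = 0]. *)
  pose B (d z : C) := exists2 j, gram_close (d / (M + 1)) g j & z = f j.
  have M1 : 0 < M + 1 by rewrite ltr_wpDl.
  have [|z zB /(_ z)] := @complex_approximations_complete R B.
    split=> [d d0|d d' _ _ d0 d'0 [j gj ->] [j' gj' ->]].
      have [|j gj] := @rkhs_approx g (d / (M + 1)); first by rewrite divr_gt0.
      by exists (f j); exists j.
    have dM : 0 <= d / (M + 1) by rewrite divr_ge0 ?(ltW d0) ?(ltW M1).
    have d'M : 0 <= d' / (M + 1) by rewrite divr_ge0 ?(ltW d'0) ?(ltW M1).
    apply: le_trans (rkhs_dist M0 fM gj gj' dM d'M) _.
    rewrite -mulrDl mulrCA ger_pMr ?addr_gt0// ler_pdivrMr// mul1r.
    by rewrite lerDl.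
  case; exists (M + 1); first exact: ltW.
  move=> d j d0 gj; rewrite mulrC; apply: zB; first by rewrite mulr_gt0.
  by exists j => //; rewrite mulfK ?gt_eqF.
(* [N] comes with the chosen limit and is not controlled by [M]; passing through a finer [j]
   replaces it by [M]. *)
apply/ler_addgt0Pr => d d0.
have NM : 0 < N + M + 1 by rewrite ltr_wpDl ?addr_ge0.
have dNM : 0 < d / (N + M + 1) by rewrite divr_gt0.
have [j gj] := rkhs_approx g dNM.
apply: le_trans (ler_distD (f j) _ _) _.
apply: le_trans (lerD (fN _ _ dNM gj) (rkhs_dist M0 fM gj gi (ltW dNM) (ltW e0))) _.
rewrite mulrDr addrA [leRHS]addrC lerD2r -mulrDl mulrCA ger_pMr//.
by rewrite ler_pdivrMr// mul1r lerDl.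
Qed.

Lemma rkhs_section_subproof i : G^~ i \in rkhs_pred.
Proof. by rewrite inE => e e0; exists i; apply: gram_close_gram; exact: ltW. Qed.

Definition rkhs_section i : rkhs := RKHS (rkhs_section_subproof i).

Lemma rkhs_dot_section f i : rkhs_dot f (rkhs_section i) = f i.
Proof.
have [M M0 fM] := rkhs_bounded f.
apply: (@dist_small_eq _ C M _ _ M0) => e e0; apply: rkhs_dotP => //.
by apply: gram_close_gram; exact: ltW.
Qed.

Lemma rkhs_dot_linear c f g h :
  rkhs_dot (c *: f + g) h = c * rkhs_dot f h + rkhs_dot g h.
Proof.
have [M M0 fM] := rkhs_bounded f; have [N N0 gN] := rkhs_bounded g.
have MN0 : 0 <= `|c| * M + N by rewrite addr_ge0 ?mulr_ge0.
apply: (@dist_small_eq _ C (`|c| * M + N + (`|c| * M + N))) => [|e e0].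
  by rewrite addr_ge0.
have [i hi] := rkhs_approx h e0.
apply: le_trans (ler_distD ((c *: f + g : rkhs) i) _ _) _; rewrite mulrDl lerD//.
  by apply: rkhs_dotP => //; exact: gram_bounded_lin.
rewrite distrC rkhs_evalP [X in `|X|](_ : _ =
  c * (rkhs_dot f h - f i) + (rkhs_dot g h - g i)); last by ring.
apply: le_trans (ler_normD _ _) _; rewrite mulrDl lerD ?rkhs_dotP//.
by rewrite normrM -mulrA ler_wpM2l// rkhs_dotP.
Qed.

(** [g] is replaced by a nearby section [i], for which the inner product is [f i]; testing at [i]
    shows that the norm of this section exceeds [N] by no more than the distance. *)
Lemma rkhs_dot_le f g M N : 0 <= M -> 0 <= N -> gram_bounded M f -> gram_bounded N g ->
  `|rkhs_dot f g| <= M * N.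
Proof.
move=> M0 N0 fM gN; apply/ler_addgt0Pr => d d0.
have M1 : 0 < M + 1 by rewrite ltr_wpDl.
have e0 : 0 < d / 2 / (M + 1) by rewrite !divr_gt0.
have Mde : M * (d / 2 / (M + 1)) <= d / 2.
  by rewrite mulrCA ger_pMr ?divr_gt0// ler_pdivrMr// mul1r lerDl.
have [i gi] := rkhs_approx g e0.
have iN : gram_norm i <= N + d / 2 / (M + 1).
  have [->|i0] := eqVneq (gram_norm i) 0; first by rewrite addr_ge0 ?(ltW e0).
  have : gram_norm i ^+ 2 <= (N + d / 2 / (M + 1)) * gram_norm i.
    rewrite -[leLHS]ger0_norm ?exprn_ge0 ?gram_norm_ge0// gram_normK -[G i i](subrK (g i)).
    apply: le_trans (ler_normD _ _) _; rewrite mulrDl addrC lerD ?gN// distrC.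
    exact: (gi i).
  by rewrite expr2 ler_pM2r// lt_def i0 gram_norm_ge0.
rewrite -[rkhs_dot f g](subrK (f i)) (le_trans (ler_normD _ _))//.
apply: le_trans (lerD (rkhs_dotP M0 fM e0 gi) (fM i)) _.
apply: le_trans (lerD Mde (ler_wpM2l M0 iN)) _.
by rewrite mulrDr addrC -addrA lerD2l [leRHS]splitr lerD2r.
Qed.

Lemma rkhs_dot_sectionl f j : rkhs_dot (rkhs_section j) f = (f j)^*.
Proof.
apply: (@dist_small_eq _ C (gram_norm j + gram_norm j)) => [|e e0].
  by rewrite addr_ge0 ?gram_norm_ge0.
have [i fi] := rkhs_approx f e0.
apply: le_trans (ler_distD (G i j) _ _) _; rewrite mulrDl lerD//.
  exact: (@rkhs_dotP (rkhs_section j) f _ e i (gram_norm_ge0 j) (@gram_bounded_gram j)).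
rewrite (gram_herm (gramP G)) -rmorphB norm_conjC distrC mulrC; exact: (fi j).
Qed.

Lemma rkhs_dotC f g : rkhs_dot f g = (rkhs_dot g f)^*.
Proof.
have [M M0 fM] := rkhs_bounded f.
apply: (@dist_small_eq _ C (M + M)) => [|e e0]; first by rewrite addr_ge0.
have [j gj] := rkhs_approx g e0.
apply: le_trans (ler_distD (f j) _ _) _; rewrite mulrDl lerD//.
  exact: rkhs_dotP.
rewrite -[f j]conjCK -rkhs_dot_sectionl -rmorphB norm_conjC distrC.
have -> : rkhs_dot g f - rkhs_dot (rkhs_section j) f =
    rkhs_dot (-1 *: rkhs_section j + g) f.
  by rewrite rkhs_dot_linear mulN1r addrC.
rewrite mulrC; apply: rkhs_dot_le => //; first exact: ltW.
by move=> l; rewrite rkhs_evalP mulN1r addrC; exact: (gj l).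
Qed.

Lemma rkhs_dot_ge0 f : 0 <= rkhs_dot f f.
Proof.
have [M M0 fM] := rkhs_bounded f.
have fR : rkhs_dot f f \is Num.real by apply/CrealP; rewrite -rkhs_dotC.
rewrite -oppr_le0; apply/ler_addgt0Pr => d d0; rewrite add0r.
pose K : C := M + (M + 1) + 1.
have K0 : 0 < K by rewrite ltr_wpDl// !addr_ge0.
(* This choice ensures both [e <= 1], so that the section [i] has norm at most [M + 1], and
   [K * e <= d]. *)
pose e : C := d / (d + K).
have dK0 : 0 < d + K by rewrite addr_gt0.
have e0 : 0 < e by rewrite divr_gt0.
have e1 : e <= 1 by rewrite ler_pdivrMr// mul1r lerDl ltW.
have Ked : (M + (M + 1)) * e <= d.
  rewrite mulrCA ger_pMr// ler_pdivrMr// mul1r /K addrA addrCA lerDl.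
  by rewrite addr_ge0 ?(ltW d0).
have [i fi] := rkhs_approx f e0.
have iM : gram_norm i <= M + 1.
  have [->|i0] := eqVneq (gram_norm i) 0; first by rewrite addr_ge0.
  have : gram_norm i ^+ 2 <= (M + 1) * gram_norm i.
    rewrite -[leLHS]ger0_norm ?exprn_ge0 ?gram_norm_ge0// gram_normK -[G i i](subrK (f i)).
    apply: le_trans (ler_normD _ _) _; rewrite mulrDl addrC lerD ?fM// distrC.
    by apply: le_trans (fi i) _; rewrite ler_wpM2r ?gram_norm_ge0.
  by rewrite expr2 ler_pM2r// lt_def i0 gram_norm_ge0.
have Gii : 0 <= G i i := gram_ge0 (gramP G) i.
apply: (@le_trans _ _ (G i i - rkhs_dot f f)); first by rewrite lerDr.
apply: le_trans (real_ler_norm _) _; first by rewrite rpredB// ger0_real.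
apply: le_trans Ked; rewrite distrC.
apply: le_trans (ler_distD (f i) _ _) _; rewrite mulrDl lerD//.
  exact: rkhs_dotP.
by apply: le_trans (fi i) _; rewrite mulrC ler_wpM2r ?(ltW e0).
Qed.

Lemma rkhs_dot_is_gram : is_gram (fun f g => rkhs_dot g f).
Proof.
split=> [f g|f|c f g]; [exact: rkhs_dotC|exact: rkhs_dot_ge0|].
by exists (c *: f + g) => h; exact: rkhs_dot_linear.
Qed.

Definition rkhs_norm f : C := sqrtC (rkhs_dot f f).

Lemma rkhs_norm_ge0 f : 0 <= rkhs_norm f.
Proof. by rewrite sqrtC_ge0 rkhs_dot_ge0. Qed.

Lemma gram_bounded_rkhs_norm f : gram_bounded (rkhs_norm f) f.
Proof.
move=> l; rewrite -rkhs_dot_section.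
have := gram_CauchySchwarz (rkhs_section l) f rkhs_dot_is_gram.
by rewrite (rkhs_dot_section (rkhs_section l)) mulrC.
Qed.

(** Together with [gram_bounded_rkhs_norm], this makes the Hilbert norm the least bound of [f] as a
    functional, so later norm estimates only need values at indices. *)
Lemma rkhs_norm_le f M : 0 <= M -> gram_bounded M f -> rkhs_norm f <= M.
Proof.
move=> M0 fM; have := rkhs_dot_le M0 M0 fM fM.
rewrite ger0_norm ?rkhs_dot_ge0// -expr2 => le.
by rewrite -(sqrCK M0) ler_sqrtC ?nnegrE ?rkhs_dot_ge0 ?exprn_ge0.
Qed.

Lemma rkhs_normD f g : rkhs_norm (f + g) <= rkhs_norm f + rkhs_norm g.
Proof.
apply: rkhs_norm_le; first by rewrite addr_ge0 ?rkhs_norm_ge0.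
move=> l; apply: le_trans (ler_normD (f l) (g l)) _.
by rewrite mulrDl lerD ?gram_bounded_rkhs_norm.
Qed.

Lemma rkhs_normZ c f : rkhs_norm (c *: f) = `|c| * rkhs_norm f.
Proof.
have dotZ g : rkhs_dot (c *: f) g = c * rkhs_dot f g.
  have := rkhs_dot_linear c f 0 g; rewrite addr0 => ->.
  by have := rkhs_dot_linear (-1) 0 0 g; rewrite scaler0 addr0 mulN1r addNr => ->; rewrite addr0.
rewrite /rkhs_norm dotZ rkhs_dotC dotZ rmorphM/= -rkhs_dotC mulrA -normCK.
by rewrite sqrtCM ?nnegrE ?exprn_ge0 ?rkhs_dot_ge0// sqrCK.
Qed.

Lemma rkhs_norm0_eq0 f : rkhs_norm f = 0 -> f = 0.
Proof.
move=> f0; apply: rkhs_ext => l; apply/eqP; rewrite rkhs_eval0 -normr_le0.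
by have := @gram_bounded_rkhs_norm f l; rewrite f0 mul0r.
Qed.

HB.instance Definition _ :=
  Lmodule_isNormed.Build C rkhs rkhs_normD rkhs_normZ rkhs_norm0_eq0.

(** Evaluation at [l] is bounded by [gram_norm l], which yields a pointwise limit [L]. The estimates
    are uniform in [l] relative to [gram_norm l], so [L] is itself a limit of sections and the
    convergence holds in norm. *)
Lemma rkhs_complete (F : set_system rkhs) : ProperFilter F -> cauchy F -> cvg F.
Proof.
move=> FF /cauchyP Fc.
pose B l (e z : C) := exists f d,
  [/\ 0 < d, F (ball f d), d * gram_norm l <= e & z = f l].
have [L LP] : exists L : I -> C, forall l e z, 0 < e -> B l e z -> `|L l - z| <= e.
  suff /choice[L LP] l : exists z, forall e z', 0 < e -> B l e z' -> `|z - z'| <= e.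
    by exists L.
  apply: complex_approximations_complete; split=> [e e0|].
    have l1 : 0 < gram_norm l + 1 by rewrite ltr_wpDl ?gram_norm_ge0.
    have d0 : 0 < e / (gram_norm l + 1) by rewrite divr_gt0.
    have [f Ff] := Fc _ d0; exists (f l), f, (e / (gram_norm l + 1)); split=> //.
    by rewrite mulrAC ler_pdivrMr// ler_pM2l// lerDl.
  move=> e e' _ _ e0 e'0 [f [d [d0 Fd de ->]]] [f' [d' [d'0 Fd' de' ->]]].
  have [g [fg f'g]] := filter_ex (filterI Fd Fd').
  move: fg f'g; rewrite -!ball_normE /ball_/= => /ltW fg /ltW f'g.
  apply: le_trans (ler_distD (g l) _ _) _; apply: lerD.
    apply: le_trans de; apply: le_trans (gram_bounded_rkhs_norm (f - g) l) _.
    by rewrite ler_wpM2r ?gram_norm_ge0.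
  rewrite distrC; apply: le_trans de'; apply: le_trans (gram_bounded_rkhs_norm (f' - g) l) _.
  by rewrite ler_wpM2r ?gram_norm_ge0.
have LF f d : 0 < d -> F (ball f d) -> gram_bounded d (fun l => L l - f l).
  move=> d0 Fd l; apply/ler_addgt0Pr => e e0; apply: LP.
    by rewrite ltr_wpDl// mulr_ge0 ?gram_norm_ge0 ?(ltW d0).
  by exists f, d; split=> //; rewrite lerDl ltW.
have Lrkhs : L \in rkhs_pred.
  rewrite inE => e e0; have e2 : 0 < e / 2 by rewrite divr_gt0.
  have [f Ff] := Fc _ e2; have [i fi] := rkhs_approx f e2; exists i => l.
  apply: le_trans (ler_distD (f l) _ _) _; rewrite [e]splitr [leRHS]mulrDl.
  by apply: lerD; [exact: LF|exact: (fi l)].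
pose g := RKHS Lrkhs; apply/cvg_ex; exists g.
apply/fcvg_ballP => e e0; have e3 : 0 < e / 3 by rewrite divr_gt0.
have [f Ff] := Fc _ e3.
have gf : `|g - f| <= e / 3 by apply: rkhs_norm_le; [exact: ltW|exact: LF].
apply: filterS Ff => h.
rewrite -!ball_normE /ball_/= => /ltW fh.
apply: le_lt_trans (ler_distD f _ _) _.
apply: le_lt_trans (lerD gf fh) _.
by rewrite [ltRHS](_ : e = e / 3 + e / 3 + e / 3) ?ltrDl//; field.
Qed.

HB.instance Definition _ := Uniform_isComplete.Build rkhs rkhs_complete.

Lemma rkhs_dot_zmod_morphisml g : zmod_morphism (rkhs_dot^~ g).
Proof. by move=> f f'; rewrite -scaleN1r addrC rkhs_dot_linear mulN1r addrC. Qed.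

Lemma rkhs_dot_scalablel g : scalable_for *%R (rkhs_dot^~ g).
Proof.
move=> c f; have := rkhs_dot_linear c f 0 g; rewrite addr0 => ->.
by have := rkhs_dot_zmod_morphisml g 0 0; rewrite /= !subrr => ->; rewrite addr0.
Qed.

Lemma rkhs_dot_zmod_morphismr f : zmod_morphism (rkhs_dot f).
Proof.
by move=> g h; rewrite rkhs_dotC rkhs_dot_zmod_morphisml rmorphB/= -!rkhs_dotC.
Qed.

Lemma rkhs_dot_scalabler f : scalable_for (@Num.conj C \; *%R) (rkhs_dot f).
Proof.
by move=> c g; rewrite rkhs_dotC rkhs_dot_scalablel rmorphM/= -rkhs_dotC.
Qed.

HB.instance Definition _ := isBilinear.Build C rkhs rkhs C *%R
  (@Num.conj C \; *%R) rkhs_dot rkhs_dot_zmod_morphisml rkhs_dot_zmod_morphismr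
  rkhs_dot_scalablel rkhs_dot_scalabler.

Lemma rkhs_dot_hermitian f g : rkhs_dot f g = (-1) ^+ false * (rkhs_dot g f)^*.
Proof. by rewrite expr0 mul1r -rkhs_dotC. Qed.

HB.instance Definition _ := isHermitianSesquilinear.Build C rkhs false
  (@Num.conj C : C -> C) rkhs_dot rkhs_dot_hermitian.

Lemma rkhs_dot_gt0 f : f != 0 -> 0 < rkhs_dot f f.
Proof.
move=> f0; rewrite lt_def rkhs_dot_ge0 andbT; apply: contra f0 => /eqP f0.
by apply/eqP/rkhs_norm0_eq0; rewrite /rkhs_norm f0 sqrtC0.
Qed.

HB.instance Definition _ := isDotProduct.Build C rkhs rkhs_dot rkhs_dot_gt0.

Lemma rkhs_dot_norm f : `|f| ^+ 2 = rkhs_dot f f.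
Proof. exact: sqrtCK. Qed.

HB.instance Definition _ :=
  CompleteNormedModule_isHilbert.Build C rkhs rkhs_dot_norm.

Lemma hdot_section f i : hdot f (rkhs_section i) = f i.
Proof. exact: rkhs_dot_section. Qed.

End RKHS.

(** * Square roots in C*-algebras *)

Section CStar.
Context {C : numClosedFieldType} {A : cstarAlgType C}.
Implicit Types (a b x y : A) (c : C).

Lemma algnorm_ge0 x : 0 <= algnorm x.
Proof. exact: (normr_ge0 (x : normed A)). Qed.

Lemma algnormN x : algnorm (- x) = algnorm x.
Proof. exact: (normrN (x : normed A)). Qed.

Lemma algnormB_sym x y : algnorm (x - y) = algnorm (y - x).
Proof. by rewrite -algnormN opprB. Qed.

Lemma star_additive : {morph (@star C A) : x y / x - y}.
Proof. by move=> x y; rewrite starD -[- y]scaleN1r starZ rmorphN rmorph1 scaleN1r. Qed.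

Lemma star0 : star (0 : A) = 0.
Proof. by have := star_additive 0 0; rewrite !subrr. Qed.

Lemma star1 : star (1 : A) = 1.
Proof. by rewrite -[LHS]mulr1 -{2}[1]starK -starM mulr1 starK. Qed.

Lemma algnorm_star x : algnorm (star x) = algnorm x.
Proof.
have le y : algnorm y <= algnorm (star y).
  have [->|y0] := eqVneq (algnorm y) 0; first exact: algnorm_ge0.
  have := algnormM (star y) y; rewrite cstar_identity expr2.
  by rewrite ler_pM2r// lt_def y0 algnorm_ge0.
by apply/eqP; rewrite eq_le le andbT -{2}[x]starK le.
Qed.

End CStar.

Section SquareRoot.
Context {R : realType} {A : cstarAlgType R[i]}.
Local Notation C := R[i].
Implicit Types (a b x y : A) (c e : C).

Lemma pow2_small e : 0 < e -> exists n, 2^-1 ^+ n <= e.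
Proof.
move=> e0; have eR : e = (complex.Re e)%:C%C by rewrite RRe_real ?gtr0_real.
have r0 : 0 < complex.Re e by move: e0; rewrite eR ltcR.
have [n nP] : exists n : nat, (complex.Re e)^-1 < n%:R.
  exists (Num.bound (complex.Re e)^-1); apply: archi_boundP.
  by rewrite invr_ge0 ltW.
exists n; rewrite eR -(rmorph_nat (real_complex R)) -fmorphV -rmorphXn lecR.
rewrite exprVn invf_ple ?posrE ?exprn_gt0//.
apply: le_trans (ltW nP) _; rewrite -natrX ler_nat.
exact/ltnW/ltn_expl.
Qed.

(* [b] is [1 - y], where [y] is the fixed point of [y |-> (x + y ^+ 2) / 2],
   which contracts the ball of radius [1 / 2] *)
Lemma cstar_sqrt x : star x = x -> algnorm x <= 2^-1 ->
  exists2 b, star b = b & b * b = 1 - x.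
Proof.
move=> xs xh; pose Phi y := 2^-1 *: (x + y * y).
have h0 : 0 <= 2^-1 :> C by rewrite invr_ge0.
have hh : 2^-1 + 2^-1 = 1 :> C by rewrite [RHS]splitr mul1r.
have Phi_ball y : algnorm y <= 2^-1 -> algnorm (Phi y) <= 2^-1.
  move=> yh; rewrite algnormZ ger0_norm// ger_pMr ?invr_gt0//.
  apply: le_trans (algnormD _ _) _; rewrite -hh lerD//.
  apply: le_trans (algnormM _ _) _.
  apply: le_trans (ler_pM _ _ yh yh) _; rewrite ?algnorm_ge0//.
  by rewrite ger_pMr ?invr_gt0// invf_le1 ?ler1n.
have Phi_contr y y' : algnorm y <= 2^-1 -> algnorm y' <= 2^-1 ->
    algnorm (Phi y - Phi y') <= 2^-1 * algnorm (y - y').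
  move=> yh yh'; rewrite -scalerBr algnormZ ger0_norm// ler_wpM2l//.
  have -> : x + y * y - (x + y' * y') = y * (y - y') + (y - y') * y'.
    by rewrite opprD addrACA subrr add0r mulrBr mulrBl addrA subrK.
  apply: le_trans (algnormD _ _) _; rewrite -[leRHS]mul1r -hh [leRHS]mulrDl.
  apply: lerD; apply: le_trans (algnormM _ _) _.
    by rewrite ler_wpM2r ?algnorm_ge0.
  by rewrite mulrC ler_wpM2r ?algnorm_ge0.
have dist_tri y y' w : algnorm (y - w) <= algnorm (y - y') + algnorm (y' - w).
  by apply: le_trans (algnormD _ _); rewrite addrA subrK.
(* By the contraction factor 1/2, two points with residuals at most [e / 2] and [e' / 2] are at
   distance at most [e + e']. *)
pose B (e : C) (y : normed A) :=
  algnorm (y : A) <= 2^-1 /\ algnorm (Phi y - y) <= 2^-1 * e.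
have Bapp : approximations B.
  split=> [e e0|e e' y y' e0 e'0 [yh yP] [y'h y'P]].
    have [n ne] := pow2_small e0; pose u k := iter k Phi 0.
    have uh k : algnorm (u k) <= 2^-1.
      elim: k => [|k IH]; last exact: Phi_ball.
      by rewrite (_ : algnorm _ = 0)//; exact: (normr0 (normed A)).
    exists (u n); split; first exact: uh.
    apply: (@le_trans _ _ (2^-1 * 2^-1 ^+ n)); last by rewrite ler_wpM2l.
    elim: n {ne} => [|n IH]; first by rewrite expr0 mulr1 (_ : u 0%N = 0)// subr0; exact: (uh 1%N).
    apply: le_trans (Phi_contr _ _ (uh n.+1) (uh n)) _.
    by rewrite exprS ler_wpM2l.
  rewrite -[`|y - y'|]/(algnorm ((y : A) - y')) -(@ler_pM2l _ 2^-1) ?invr_gt0//.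
  rewrite -(lerD2l (2^-1 * algnorm ((y : A) - y'))) -mulrDl hh mul1r.
  apply: le_trans (dist_tri _ (Phi y) _) _.
  apply: le_trans (lerD (lexx _) (dist_tri _ (Phi y') _)) _.
  rewrite algnormB_sym mulrDr [leLHS]addrCA.
  by apply: lerD; [exact: Phi_contr|exact: lerD].
have [z' z'B] := approximations_complete Bapp; pose z : A := z'.
have zB e y : 0 < e -> B e y -> algnorm (z - y) <= e := z'B e y.
have zh : algnorm z <= 2^-1.
  apply/ler_addgt0Pr => e e0; have [y By] := Bapp.1 e e0.
  rewrite -(subrK (y : A) z); apply: le_trans (algnormD _ _) _.
  by rewrite addrC; apply: lerD; [exact: By.1|exact: zB].
have zfix : Phi z = z.
  apply: (@dist_small_eq _ (normed A) (2^-1 + (2^-1 + 1))) => [|e e0].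
    by rewrite !addr_ge0.
  have [y By] := Bapp.1 e e0; rewrite mulrDl.
  apply: le_trans (dist_tri _ (Phi y) _) _; apply: lerD.
    apply: le_trans (Phi_contr _ _ zh By.1) _; rewrite ler_wpM2l//.
    exact: zB.
  apply: le_trans (dist_tri _ (y : A) _) _; rewrite mulrDl mul1r.
  apply: lerD; first exact: By.2.
  by rewrite algnormB_sym; exact: zB.
(* [star z] is a fixed point too because [x] is self-adjoint, and a contraction has only one in the
   ball. *)
have zs : star z = z.
  have szfix : Phi (star z) = star z.
    by rewrite -[in RHS]zfix /Phi starZ starD starM xs fmorphV rmorph_nat.
  apply/eqP; rewrite eq_sym -subr_eq0; apply/eqP/algnorm0_eq0/eqP.
  have := Phi_contr z (star z) zh; rewrite algnorm_star zfix szfix => /(_ zh).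
  set N := algnorm _ => NN.
  have : 2^-1 * N + 2^-1 * N <= 2^-1 * N by rewrite -mulrDl hh mul1r.
  rewrite gerDl.
  rewrite pmulr_rle0 ?invr_gt0// => le0.
  by rewrite eq_le le0 algnorm_ge0.
have zz : z * z = z + z - x.
  by rewrite -[in RHS]zfix /Phi -scalerDl hh scale1r addrAC subrr add0r.
exists (1 - z); first by rewrite star_additive star1 zs.
rewrite mulrBl mul1r mulrBr mulr1 zz (_ : z - (z + z - x) = x - z).
  by rewrite opprB addrA subrK.
by rewrite -addrA opprD addrA subrr add0r opprB.
Qed.

(** For nonzero [a], the C*-identity gives [star a * a / c] exactly the norm 1/2 allowed in
    [cstar_sqrt]. The root found there is self-adjoint, so its square has the form [star b * b];
    rescaling by [sqrtC c] concludes. *)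
Lemma cstar_norm_bound a : exists b,
  star b * b = (2 * algnorm a ^+ 2)%:A - star a * a.
Proof.
have [a0|a0] := eqVneq (algnorm a) 0.
  exists 0; rewrite a0 expr2 !mulr0 scale0r (algnorm0_eq0 _ a0).
  by rewrite mulr0 subr0.
pose c : C := 2 * algnorm a ^+ 2.
have c0 : 0 < c by rewrite mulr_gt0// exprn_gt0// lt_def a0 algnorm_ge0.
pose x := c^-1 *: (star a * a).
have cs : c^* = c by rewrite conj_Creal ?gtr0_real.
have [||b bs bb] := @cstar_sqrt x.
- by rewrite starZ starM starK fmorphV/= cs.
- rewrite algnormZ cstar_identity normfV gtr0_norm//.
  by rewrite /c invfM -mulrA mulVf ?mulr1// expf_neq0.
exists (sqrtC c *: b); rewrite starZ bs conj_Creal; last first.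
  by rewrite ger0_real// sqrtC_ge0 ltW.
rewrite -scalerAl -scalerAr scalerA -expr2 sqrtCK bb scalerBr /x scalerA.
by rewrite divff ?gt_eqF// scale1r.
Qed.

End SquareRoot.

(** * Operator matrices *)

Section BoundedOp.
Context {C : numClosedFieldType} {X Y : normedModType C}.
Implicit Types (f g : bounded_op X Y) (c : C) (x : X).

Lemma bounded_op_ext f g : f =1 g -> f = g.
Proof. by move=> fg; apply/val_inj/funext. Qed.

Lemma bounded_opP f : bounded_linear f.
Proof. by case: f => f /=; rewrite inE. Qed.

Lemma bounded_op_additive f : {morph f : x y / x + y}.
Proof. by move=> x y; have [fl _] := bounded_opP f; have := fl 1 x y; rewrite !scale1r. Qed.

Lemma bounded_op0 f : f 0 = 0.
Proof.
by apply: (addrI (f 0)); rewrite -bounded_op_additive !addr0.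
Qed.

Lemma bounded_opZ f c x : f (c *: x) = c *: f x.
Proof.
have [fl _] := bounded_opP f; have := fl c x 0.
by rewrite !addr0 bounded_op0 addr0.
Qed.

Lemma bounded_op_sum (I : Type) (r : seq I) (P : pred I) (F : I -> X) f :
  f (\sum_(i <- r | P i) F i) = \sum_(i <- r | P i) f (F i).
Proof. exact: (big_morph f (bounded_op_additive f) (bounded_op0 f)). Qed.

Lemma bounded_opDE f g x : (f + g) x = f x + g x. Proof. by []. Qed.
Lemma bounded_opZE c f x : (c *: f) x = c *: f x. Proof. by []. Qed.
Lemma bounded_op0E x : (0 : bounded_op X Y) x = 0. Proof. by []. Qed.

Lemma bounded_op_sumE (I : Type) (r : seq I) (P : pred I) (F : I -> bounded_op X Y) x :
  (\sum_(i <- r | P i) F i) x = \sum_(i <- r | P i) F i x.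
Proof. exact: (big_morph (fun f : bounded_op X Y => f x)). Qed.

Lemma bounded_op_norm f : exists2 M, 0 <= M & forall x, `|f x| <= M * `|x|.
Proof.
have [_ [M fM]] := bounded_opP f; exists `|M| => // x.
apply: le_trans (fM x) _; have [->|x0] := eqVneq x 0; first by rewrite !normr0 !mulr0.
rewrite ler_wpM2r// real_ler_norm//.
have := le_trans (normr_ge0 _) (fM x).
by rewrite pmulr_lge0 ?normr_gt0// => /ger0_real.
Qed.

End BoundedOp.

Lemma bounded_op_mk (C : numClosedFieldType) (X Y : normedModType C) (f : X -> Y) (M : C) :
  linear f -> (forall x, `|f x| <= M * `|x|) ->
  exists g : bounded_op X Y, g =1 f.
Proof.
move=> fl fM; have fP : f \in @bounded_linear_pred C X Y by rewrite inE; split=> //; exists M.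
by exists (BoundedOp fP).
Qed.

Section Column.
Context {C : numClosedFieldType} {X : lmodType C}.

Definition col_at n (i : 'I_n) (x : X) : 'cV[X]_n :=
  \col_k (if k == i then x else 0).

Lemma col_atD n (i : 'I_n) x y : col_at i (x + y) = col_at i x + col_at i y.
Proof. by apply/colP => k; rewrite !mxE; case: eqP => _; rewrite ?addr0. Qed.

Lemma col_atZ n (i : 'I_n) c x : col_at i (c *: x) = map_mx ( *:%R c) (col_at i x).
Proof. by apply/colP => k; rewrite !mxE; case: eqP => _; rewrite ?scaler0. Qed.

Lemma col_sum_at n (x : 'cV[X]_n) : x = \sum_i col_at i (x i 0).
Proof.
apply/colP => k; rewrite summxE (bigD1 k)//= mxE eqxx big1 ?addr0// => i ik.
by rewrite mxE eq_sym (negPf ik).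
Qed.

End Column.

Section OperatorMatrix.
Context {C : numClosedFieldType} {X Y : normedModType C}.
Implicit Types c : C.

Lemma mxopDr n m (T : 'M[bounded_op X Y]_(n, m)) x y :
  mxop T (x + y) = mxop T x + mxop T y.
Proof.
apply/colP => i; rewrite !mxE -big_split; apply: eq_bigr => j _.
by rewrite mxE bounded_op_additive.
Qed.

Lemma mxopZr n m (T : 'M[bounded_op X Y]_(n, m)) c x :
  mxop T (map_mx ( *:%R c) x) = map_mx ( *:%R c) (mxop T x).
Proof.
apply/colP => i; rewrite !mxE scaler_sumr; apply: eq_bigr => j _.
by rewrite mxE bounded_opZ.
Qed.

Lemma mxopDl n m (T T' : 'M[bounded_op X Y]_(n, m)) x :
  mxop (T + T') x = mxop T x + mxop T' x.
Proof.
apply/colP => i; rewrite !mxE -big_split; apply: eq_bigr => j _.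
by rewrite mxE bounded_opDE.
Qed.

Lemma mxopZl n m (T : 'M[bounded_op X Y]_(n, m)) c x :
  mxop (map_mx ( *:%R c) T) x = map_mx ( *:%R c) (mxop T x).
Proof.
apply/colP => i; rewrite !mxE scaler_sumr; apply: eq_bigr => j _.
by rewrite mxE bounded_opZE.
Qed.

Lemma mxop0l n m x : mxop (0 : 'M[bounded_op X Y]_(n, m)) x = 0.
Proof.
by apply/colP => i; rewrite !mxE big1// => j _; rewrite mxE bounded_op0E.
Qed.

Lemma mxop_suml n m (I : Type) (r : seq I) (P : pred I)
    (F : I -> 'M[bounded_op X Y]_(n, m)) x :
  mxop (\sum_(i <- r | P i) F i) x = \sum_(i <- r | P i) mxop (F i) x.
Proof.
by apply: (big_morph (fun T => mxop T x)) => [T T'|]; [exact: mxopDl|exact: mxop0l].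
Qed.

Lemma mxop_col_at n m (T : 'M[bounded_op X Y]_(n, m)) j x i :
  mxop T (col_at j x) i 0 = T i j x.
Proof.
rewrite mxE (bigD1 j)//= mxE eqxx big1 ?addr0// => k kj.
by rewrite mxE (negPf kj) bounded_op0.
Qed.

Lemma mxop_inj n m (T T' : 'M[bounded_op X Y]_(n, m)) :
  mxop T =1 mxop T' -> T = T'.
Proof.
move=> TT'; apply/matrixP => i j; apply: bounded_op_ext => x.
by rewrite -!mxop_col_at TT'.
Qed.

Lemma mxop_block n n' m m' (T11 : 'M[bounded_op X Y]_(n, m)) T12 T21
    (T22 : 'M[bounded_op X Y]_(n', m')) x y :
  mxop (block_mx T11 T12 T21 T22) (col_mx x y) =
  col_mx (mxop T11 x + mxop T12 y) (mxop T21 x + mxop T22 y).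
Proof.
apply/colP => i; rewrite !mxE; case: splitP => k ik; rewrite !mxE big_split_ord/=;
  congr (_ + _); apply: eq_bigr => j _.
- by rewrite (_ : i = lshift _ k) ?block_mxEul ?col_mxEu//; exact: val_inj.
- by rewrite (_ : i = lshift _ k) ?block_mxEur ?col_mxEd//; exact: val_inj.
- by rewrite (_ : i = rshift _ k) ?block_mxEdl ?col_mxEu//; exact: val_inj.
- by rewrite (_ : i = rshift _ k) ?block_mxEdr ?col_mxEd//; exact: val_inj.
Qed.

Lemma mxop_row_mx n m m' (T : 'M[bounded_op X Y]_(n, m))
    (T' : 'M[bounded_op X Y]_(n, m')) x y :
  mxop (row_mx T T') (col_mx x y) = mxop T x + mxop T' y.
Proof.
apply/colP => i; rewrite !mxE big_split_ord/=; congr (_ + _).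
  by apply: eq_bigr => j _; rewrite row_mxEl col_mxEu.
by apply: eq_bigr => j _; rewrite row_mxEr col_mxEd.
Qed.

Lemma mxop_lmulmx n m p (a : 'M[C]_(p, n)) (T : 'M[bounded_op X Y]_(n, m)) x :
  mxop (lmulmx a T) x = lmulmx a (mxop T x).
Proof.
apply/colP => i; rewrite !mxE.
under eq_bigr do rewrite mxE bounded_op_sumE.
rewrite exchange_big; apply: eq_bigr => k _; rewrite mxE scaler_sumr.
by apply: eq_bigr.
Qed.

Lemma mxop_rmulmx n m p (T : 'M[bounded_op X Y]_(n, m)) (b : 'M[C]_(m, p)) x :
  mxop (rmulmx T b) x = mxop T (lmulmx b x).
Proof.
apply/colP => i; rewrite !mxE.
under eq_bigr do rewrite mxE bounded_op_sumE.
rewrite exchange_big; apply: eq_bigr => k _; rewrite mxE bounded_op_sum.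
by apply: eq_bigr => j _; rewrite bounded_opZ.
Qed.

End OperatorMatrix.

Section ColumnDot.
Context {C : numClosedFieldType} {Y : hilbertType C}.
Implicit Types c : C.

Lemma cdotDl n (x y w : 'cV[Y]_n) : cdot (x + y) w = cdot x w + cdot y w.
Proof. by rewrite /cdot -big_split; apply: eq_bigr => i _; rewrite mxE hdotDl. Qed.

Lemma cdotZl n c (x w : 'cV[Y]_n) : cdot (map_mx ( *:%R c) x) w = c * cdot x w.
Proof. by rewrite /cdot mulr_sumr; apply: eq_bigr => i _; rewrite mxE hdotZl. Qed.

Lemma cdotC n (x y : 'cV[Y]_n) : cdot x y = (cdot y x)^*.
Proof. by rewrite /cdot rmorph_sum; apply: eq_bigr => i _; rewrite hdotC. Qed.

Lemma cdot_ge0 n (x : 'cV[Y]_n) : 0 <= cdot x x.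
Proof. by apply: sumr_ge0 => i _; exact: hdot_ge0. Qed.

Lemma cdot_col_at n (x : 'cV[Y]_n) i y : cdot x (col_at i y) = hdot (x i 0) y.
Proof.
rewrite /cdot (bigD1 i)//= mxE eqxx big1 ?addr0// => k ki.
by rewrite mxE (negPf ki) hdot0r.
Qed.

Lemma cdot_col_atl n (x : 'cV[Y]_n) i y :
  cdot (col_at i y) x = hdot y (x i 0).
Proof. by rewrite cdotC cdot_col_at -hdotC. Qed.

Lemma cdot_inj n (x x' : 'cV[Y]_n) : cdot x =1 cdot x' -> x = x'.
Proof.
move=> xx'; apply/colP => i; apply: hdot_injl => w.
by rewrite -!cdot_col_at xx'.
Qed.

Lemma cdot_col_mx n m (x x' : 'cV[Y]_n) (y y' : 'cV[Y]_m) :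
  cdot (col_mx x y) (col_mx x' y') = cdot x x' + cdot y y'.
Proof.
rewrite /cdot big_split_ord/=; congr (_ + _); apply: eq_bigr => i _.
  by rewrite !col_mxEu.
by rewrite !col_mxEd.
Qed.

Lemma cdot_lmulmx n m (a : 'M[C]_(m, n)) (x : 'cV[Y]_n) (y : 'cV[Y]_m) :
  cdot (lmulmx a x) y = cdot x (lmulmx (ctrmx a) y).
Proof.
rewrite /cdot; under eq_bigr do rewrite mxE hdot_suml.
rewrite exchange_big; apply: eq_bigr => i _; rewrite mxE hdot_sumr.
by apply: eq_bigr => j _; rewrite !mxE hdotZl hdotZr conjCK.
Qed.

End ColumnDot.

Section Adjoint.
Context {R : realType} {X Y : hilbertType R[i]}.

Lemma adjoint_unique (T : bounded_op X Y) (T' : bounded_op Y X) :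
  (forall x y, hdot (T x) y = hdot x (T' y)) -> T' = adjoint T.
Proof.
move=> TT'; rewrite /adjoint; case: xgetP => [T2 _ T2P|/(_ T')]; last by case.
by apply: bounded_op_ext => y; apply: hdot_inj => x; rewrite -TT' T2P.
Qed.

(** Riesz' theorem applied to [x |-> hdot (T x) w] shows that the set defining [adjoint] is
    inhabited, so its default value is not taken by accident. *)
Lemma adjointP (T : bounded_op X Y) x y : hdot (T x) y = hdot x (adjoint T y).
Proof.
suff [T' T'P] : exists T' : bounded_op Y X, forall x y, hdot (T x) y = hdot x (T' y).
  by rewrite -(adjoint_unique T'P).
have [M M0 TM] := bounded_op_norm T.
have /choice[S SP] w : exists z, forall x, hdot (T x) w = hdot x z.
  apply: (@Riesz_representation _ _ (fun v => hdot (T v) w) (M * `|w|)).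
    by move=> c u v; rewrite bounded_op_additive bounded_opZ hdotDl hdotZl.
  move=> v; apply: le_trans (hdot_CauchySchwarz _ _) _.
  by rewrite [leRHS]mulrAC; apply: ler_wpM2r => //; exact: TM.
have [||T' T'S] := @bounded_op_mk _ Y X S M.
- by move=> c u v; apply: hdot_inj => w; rewrite hdotDr hdotZr -!SP hdotDr hdotZr.
- move=> v; have [->|S0] := eqVneq (S v) 0; first by rewrite normr0 mulr_ge0.
  (* The bound comes from [|S v|^2 = <T (S v), v>] after division by [|S v|]. *)
  rewrite -(ler_pM2l (x := `|S v|)) ?normr_gt0// -expr2 hdot_norm -SP.
  rewrite -[leLHS]ger0_norm; last by rewrite SP hdot_ge0.
  apply: le_trans (hdot_CauchySchwarz _ _) _.
  by rewrite mulrA [_ * M]mulrC; apply: ler_wpM2r => //; exact: TM.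
- by exists T' => u v; rewrite T'S SP.
Qed.

Lemma cdot_mxop n m (T : 'M[bounded_op X Y]_(n, m)) x y :
  cdot (mxop T x) y = cdot x (mxop (adjointmx T) y).
Proof.
rewrite /cdot; under eq_bigr do rewrite mxE hdot_suml.
rewrite exchange_big; apply: eq_bigr => i _; rewrite mxE hdot_sumr.
by apply: eq_bigr => j _; rewrite !mxE adjointP.
Qed.

End Adjoint.

(** * Global kernels and their Gram matrices *)

Section ScalarMatrixTheory.
Context {C : numClosedFieldType} {V : lmodType C}.

Lemma map_scale1 n m (P : 'M[V]_(n, m)) : map_mx ( *:%R 1) P = P.
Proof. by apply/matrixP => i j; rewrite mxE scale1r. Qed.

Lemma lmul1mx n m (Z : 'M[V]_(n, m)) : lmulmx 1%:M Z = Z.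
Proof.
apply/matrixP => i j; rewrite mxE (bigD1 i)//= mxE eqxx scale1r big1 ?addr0//.
by move=> k ki; rewrite mxE eq_sym (negPf ki) scale0r.
Qed.

Lemma rmulmx1 n m (Z : 'M[V]_(n, m)) : rmulmx Z 1%:M = Z.
Proof.
apply/matrixP => i j; rewrite mxE (bigD1 j)//= mxE eqxx scale1r big1 ?addr0//.
by move=> k ki; rewrite mxE (negPf ki) scale0r.
Qed.

Lemma lmul0mx p n m (Z : 'M[V]_(n, m)) : lmulmx (0 : 'M_(p, n)) Z = 0.
Proof. by apply/matrixP => i j; rewrite !mxE big1// => k _; rewrite mxE scale0r. Qed.

Lemma rmulmx0 p n m (Z : 'M[V]_(n, m)) : rmulmx Z (0 : 'M_(m, p)) = 0.
Proof. by apply/matrixP => i j; rewrite !mxE big1// => k _; rewrite mxE scale0r. Qed.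

Lemma lmul_row_col p n n' m (a : 'M[C]_(p, n)) (b : 'M_(p, n'))
    (Z : 'M[V]_(n, m)) Z' :
  lmulmx (row_mx a b) (col_mx Z Z') = lmulmx a Z + lmulmx b Z'.
Proof.
apply/matrixP => i j; rewrite !mxE big_split_ord/=; congr (_ + _).
  by apply: eq_bigr => k _; rewrite row_mxEl col_mxEu.
by apply: eq_bigr => k _; rewrite row_mxEr col_mxEd.
Qed.

Lemma rmul_row_col p n m m' (Z : 'M[V]_(n, m)) (Z' : 'M_(n, m'))
    (a : 'M[C]_(m, p)) b :
  rmulmx (row_mx Z Z') (col_mx a b) = rmulmx Z a + rmulmx Z' b.
Proof.
apply/matrixP => i j; rewrite !mxE big_split_ord/=; congr (_ + _).
  by apply: eq_bigr => k _; rewrite row_mxEl col_mxEu.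
by apply: eq_bigr => k _; rewrite row_mxEr col_mxEd.
Qed.

Lemma rmul_mx_row p p' n m (Z : 'M[V]_(n, m)) (a : 'M[C]_(m, p)) (b : 'M_(m, p')) :
  rmulmx Z (row_mx a b) = row_mx (rmulmx Z a) (rmulmx Z b).
Proof.
apply/matrixP => i j; rewrite !mxE; case: splitP => k jk; rewrite mxE;
  apply: eq_bigr => l _.
  by rewrite (_ : j = lshift _ k) ?row_mxEl//; exact: val_inj.
by rewrite (_ : j = rshift _ k) ?row_mxEr//; exact: val_inj.
Qed.

Lemma ctrmx1 n : ctrmx (1%:M : 'M[C]_n) = 1%:M.
Proof. by rewrite /ctrmx tr_scalar_mx map_scalar_mx rmorph1. Qed.

Lemma ctrmx_row n m m' (a : 'M[C]_(n, m)) (b : 'M_(n, m')) :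
  ctrmx (row_mx a b) = col_mx (ctrmx a) (ctrmx b).
Proof. by rewrite /ctrmx tr_row_mx map_col_mx. Qed.

Lemma ctrmxK n m : cancel (@ctrmx C n m) (@ctrmx C m n).
Proof. by move=> a; apply/matrixP => i j; rewrite !mxE conjCK. Qed.

End ScalarMatrixTheory.

Section StarMatrix.
Context {C : numClosedFieldType} {A : cstarAlgType C}.

Lemma starmxK n m : cancel (@starmx C A n m) (@starmx C A m n).
Proof. by move=> P; apply/matrixP => i j; rewrite !mxE starK. Qed.

Lemma star_sum (I : Type) (r : seq I) (P : pred I) (F : I -> A) :
  star (\sum_(i <- r | P i) F i) = \sum_(i <- r | P i) star (F i).
Proof. exact: (big_morph _ (@starD C A) (@star0 C A)). Qed.

Lemma starmxD n m (P Q : 'M[A]_(n, m)) : starmx (P + Q) = starmx P + starmx Q.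
Proof. by apply/matrixP => i j; rewrite !mxE starD. Qed.

Lemma starmxM n m p (P : 'M[A]_(n, m)) (Q : 'M_(m, p)) :
  starmx (P *m Q) = starmx Q *m starmx P.
Proof.
apply/matrixP => i j; rewrite !mxE star_sum; apply: eq_bigr => k _.
by rewrite !mxE starM.
Qed.

Lemma starmx_row n m m' (P : 'M[A]_(n, m)) (Q : 'M_(n, m')) :
  starmx (row_mx P Q) = col_mx (starmx P) (starmx Q).
Proof. by rewrite /starmx tr_row_mx map_col_mx. Qed.

Lemma starmxZ n m c (P : 'M[A]_(n, m)) :
  starmx (map_mx ( *:%R c) P) = map_mx ( *:%R c^*) (starmx P).
Proof. by apply/matrixP => i j; rewrite !mxE starZ. Qed.

Lemma starmx_scalar n (a : A) : starmx (a%:M : 'M_n) = (star a)%:M.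
Proof.
apply/matrixP => i j; rewrite !mxE eq_sym.
by case: eqP => _; rewrite ?mulr1n// !mulr0n star0.
Qed.

Lemma mulmxZr n m p c (P : 'M[A]_(n, m)) (Q : 'M_(m, p)) :
  P *m map_mx ( *:%R c) Q = map_mx ( *:%R c) (P *m Q).
Proof.
apply/matrixP => i j; rewrite !mxE scaler_sumr; apply: eq_bigr => k _.
by rewrite mxE scalerAr.
Qed.

Lemma mulmxZl n m p c (P : 'M[A]_(n, m)) (Q : 'M_(m, p)) :
  map_mx ( *:%R c) P *m Q = map_mx ( *:%R c) (P *m Q).
Proof.
apply/matrixP => i j; rewrite !mxE scaler_sumr; apply: eq_bigr => k _.
by rewrite mxE scalerAl.
Qed.

Lemma mulmx_rmulmx n m p q (P : 'M[A]_(n, m)) (Q : 'M_(m, p)) (b : 'M[C]_(p, q)) :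
  P *m rmulmx Q b = rmulmx (P *m Q) b.
Proof.
apply/matrixP => i j; rewrite !mxE.
under eq_bigr do rewrite mxE mulr_sumr.
rewrite exchange_big; apply: eq_bigr => k _; rewrite mxE scaler_sumr.
by apply: eq_bigr => l _; rewrite scalerAr.
Qed.

Lemma starmx_rmulmx n m p (P : 'M[A]_(n, m)) (b : 'M[C]_(m, p)) :
  starmx (rmulmx P b) = lmulmx (ctrmx b) (starmx P).
Proof.
apply/matrixP => i j; rewrite !mxE star_sum; apply: eq_bigr => k _.
by rewrite !mxE starZ.
Qed.

(** Positivity asks for a square factor, so [v] becomes the first row of a square matrix that is
    zero elsewhere. *)
Lemma cstar_psd_row n (v : 'rV[A]_n) : (0 < n)%N -> cstar_psd (starmx v *m v).
Proof.
case: n v => // n v _.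
exists (\matrix_(i, j) (if i == 0 then v 0 j else 0)).
apply/matrixP => i j; rewrite !mxE big_ord_recl big_ord0 addr0.
rewrite big_ord_recl big1 ?addr0 ?mxE//= => k _.
by rewrite !mxE/= mulr0.
Qed.

End StarMatrix.

Section Kernel.
Context {C : numClosedFieldType} {A : cstarAlgType C} {Y : hilbertType C}.
Context {S : Type} {Omega : forall n, set 'M[S]_n} (K : kernel_fun A Y Omega).
Hypothesis gK : graded_kernel K.
Arguments Omega : clear implicits.

Lemma kernel0 n m (Z : Omega n) (W : Omega m) : K Z W 0 = 0.
Proof.
apply: (addrI (K Z W 0)).
by rewrite -{1}[K Z W 0]map_scale1 -gK !map_scale1 !addr0.
Qed.

Lemma kernelD n m (Z : Omega n) (W : Omega m) P Q :
  K Z W (P + Q) = K Z W P + K Z W Q.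
Proof. by rewrite -{1}[P]map_scale1 gK map_scale1. Qed.

Lemma kernelZ n m (Z : Omega n) (W : Omega m) c P :
  K Z W (map_mx ( *:%R c) P) = map_mx ( *:%R c) (K Z W P).
Proof. by rewrite -[map_mx _ P]addr0 gK kernel0 addr0. Qed.

Lemma kernel_sum n m (Z : Omega n) (W : Omega m) (I : Type) (r : seq I) (P : pred I) F :
  K Z W (\sum_(i <- r | P i) F i) = \sum_(i <- r | P i) K Z W (F i).
Proof. exact: (big_morph _ (kernelD Z W) (kernel0 Z W)). Qed.

(** The sizes [m1 + m2 + m3] and [m1 + (m2 + m3)] are equal but not convertible; this carries a
    kernel across such an equality. *)
Lemma kernel_cast n m m' (e : m = m') (Z : Omega n) (W : Omega m) (W' : Omega m') P :
  val W' = castmx (e, e) (val W) ->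
  K Z W' (castmx (erefl, e) P) = castmx (erefl, e) (K Z W P).
Proof.
by case: m' / e W' => W'; rewrite castmx_id => /val_inj ->; rewrite !castmx_id.
Qed.

(** * Direct sums in one argument of a global kernel *)

Section Global.
Variables (z : S) (ncO : nc_set z Omega) (glK : global_kernel z K).

Lemma nc_dsum n m (Z : Omega n) (W : Omega m) :
  exists D : Omega (n + m)%N, val D = dsum z (val Z) (val W).
Proof.
have D : dsum z (val Z) (val W) \in Omega (n + m)%N.
  by rewrite inE; apply: ncO.2; exact: set_valP.
by exists (exist (fun U => U \in Omega (n + m)%N) _ D).
Qed.

Lemma nc_size_gt0 n : Omega n -> (0 < n)%N.
Proof.
case: n => // -[Z]; have := ncO.1 => ->.
by rewrite inE.
Qed.

Lemma val_dsumA n m p (Z : Omega n) (W : Omega m) (V : Omega p)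
    (D : Omega (n + m)%N) (E : Omega (n + m + p)%N) (F : Omega (m + p)%N)
    (G : Omega (n + (m + p))%N) :
  val D = dsum z (val Z) (val W) -> val E = dsum z (val D) (val V) ->
  val F = dsum z (val W) (val V) -> val G = dsum z (val Z) (val F) ->
  val G = castmx (esym (addnA n m p), esym (addnA n m p)) (val E).
Proof.
move=> hD hE hF hG; rewrite hG hF hE hD /dsum.
have := @block_mxA _ _ _ _ _ _ _ (val Z) (const_mx z) (const_mx z) (const_mx z)
  (val W) (const_mx z) (const_mx z) (const_mx z) (val V).
by rewrite /= !row_mx_const !col_mx_const.
Qed.

(* Comparing the splittings (W1 + W2) + V and W1 + (W2 + V) of the same point. *)
Lemma kernel_dsum_cols n m1 m2 (Z : Omega n) (W1 : Omega m1) (W2 : Omega m2)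
    (E : Omega (m1 + m2)%N) P :
  val E = dsum z (val W1) (val W2) ->
  forall m3 (V : Omega m3) (F : Omega (m2 + m3)%N), val F = dsum z (val W2) (val V) ->
  forall i, (forall j, K Z E P i (lshift m2 j) = K Z W1 (lsubmx P) i j) /\
  (forall j, K Z E P i (rshift m1 j) =
     K Z F (row_mx (rsubmx P) 0) i (lshift m3 j)).
Proof.
move=> hE m3 V F hF i.
(* The row argument is doubled because the hypothesis splits both arguments; [P] is padded with zero
   rows accordingly. *)
have [D hD] := nc_dsum Z Z; have [G hG] := nc_dsum E V.
have [H hH] := nc_dsum W1 F.
have HG := val_dsumA hE hG hF hH.
have [_ glob] := glK.
have KG := glob _ _ _ _ _ _ _ _ _ _ hD hG P 0 0 0.
have KH := glob _ _ _ _ _ _ _ _ _ _ hD hH (lsubmx P) (row_mx (rsubmx P) 0) 0 0.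
pose Q := block_mx P 0 (0 : 'M_(n, _)) (0 : 'M_(n, m3)).
have KQ := kernel_cast (e := esym (addnA m1 m2 m3)) D Q HG.
have QE : castmx (erefl, esym (addnA m1 m2 m3)) Q =
    block_mx (lsubmx P) (row_mx (rsubmx P) 0) 0 0.
  have e1 : col_mx P 0 =
      row_mx (col_mx (lsubmx P) 0) (col_mx (rsubmx P) (0 : 'M_(n, m2))).
    by rewrite -block_mxEh block_mxEv row_mx0 hsubmxK.
  have e2 : col_mx (row_mx (rsubmx P) 0) 0 =
      row_mx (col_mx (rsubmx P) (0 : 'M_(n, _))) (col_mx 0 (0 : 'M_(n, m3))).
    by rewrite -block_mxEh block_mxEv row_mx0.
  by rewrite /Q !block_mxEh e1 e2 row_mxA.
have entry a b : K D H (block_mx (lsubmx P) (row_mx (rsubmx P) 0) 0 0) a b =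
    K D G Q a (cast_ord (addnA m1 m2 m3) b).
  rewrite -QE KQ castmxE cast_ord_id; congr (K D G Q a _); exact: val_inj.
split=> j.
  have := entry (lshift n i) (lshift _ j); rewrite KH block_mxEul => ->.
  rewrite KG (_ : cast_ord _ _ = lshift m3 (lshift m2 j)) ?block_mxEul//.
  exact: val_inj.
have := entry (lshift n i) (rshift m1 (lshift m3 j)); rewrite KH block_mxEur => ->.
rewrite KG (_ : cast_ord _ _ = lshift m3 (rshift m1 j)) ?block_mxEul//.
exact: val_inj.
Qed.

(** The comparison above computes the left columns outright and turns the right ones into left
    columns for the sum of [W2] with itself; a second use, at that sum, computes these. *)
Lemma kernel_dsumr n m1 m2 (Z : Omega n) (W1 : Omega m1) (W2 : Omega m2)
    (E : Omega (m1 + m2)%N) P1 P2 :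
  val E = dsum z (val W1) (val W2) ->
  K Z E (row_mx P1 P2) = row_mx (K Z W1 P1) (K Z W2 P2).
Proof.
move=> hE; have [F hF] := nc_dsum W2 W2.
apply/matrixP => i j; have [lft rgt] := kernel_dsum_cols Z (row_mx P1 P2) hE hF i.
rewrite [RHS]mxE; case: splitP => k jk.
  rewrite (_ : j = lshift _ k); last exact: val_inj.
  by rewrite lft row_mxKl.
rewrite (_ : j = rshift _ k); last exact: val_inj.
have [G hG] := nc_dsum W2 F.
have [lft' _] := kernel_dsum_cols Z (row_mx (rsubmx (row_mx P1 P2)) 0) hF hG i.
by rewrite rgt lft' row_mxKl row_mxKr.
Qed.


End Global.
End Kernel.

(** * The Gram kernel on the indices (W, v, y) *)

Section KernelGram.
Context {R : realType} {A : cstarAlgType R[i]} {Y : hilbertType R[i]}.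
Context {S : Type} {Omega : forall n, set 'M[S]_n} (K : kernel_fun A Y Omega).
Arguments Omega : clear implicits.
Local Notation C := R[i].

Record kernel_index := KernelIndex {
  kernel_size : nat ;
  kernel_point : Omega kernel_size ;
  kernel_row : 'rV[A]_kernel_size ;
  kernel_col : 'cV[Y]_kernel_size }.

(* The inner product of K_{W,v,y} and K_{Z,u,x}. The index [None] stands for
   the zero function, which is needed when Omega is empty. *)
Definition kernel_gram (j i : option kernel_index) : C :=
  match j, i with
  | Some (KernelIndex n Z u x), Some (KernelIndex m W v y) =>
      cdot (mxop (K Z W (starmx u *m v)) y) x
  | _, _ => 0
  end.

Local Notation idx Z u x := (Some (KernelIndex Z u x)).

Hypothesis gK : graded_kernel K.
Variables (z : S) (ncO : nc_set z Omega).
Hypotheses (glK : global_kernel z K) (cpK : cp_kernel K).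

Lemma kernel_gramNr j : kernel_gram j None = 0.
Proof. by case: j => // -[]. Qed.

Lemma kernel_gram_row c n (Z : Omega n) u v y l :
  kernel_gram l (idx Z (map_mx ( *:%R c) u + v) y) =
  c * kernel_gram l (idx Z u y) +
  kernel_gram l (idx Z v y).
Proof.
case: l => [[m W w x]|]; rewrite /= ?mulr0 ?addr0//.
by rewrite mulmxDr mulmxZr kernelD// kernelZ// mxopDl mxopZl cdotDl cdotZl.
Qed.

Lemma kernel_gram_col c n (Z : Omega n) u x y l :
  kernel_gram l (idx Z u (map_mx ( *:%R c) x + y)) =
  c * kernel_gram l (idx Z u x) +
  kernel_gram l (idx Z u y).
Proof.
case: l => [[m W w t]|]; rewrite /= ?mulr0 ?addr0//.
by rewrite mxopDr mxopZr cdotDl cdotZl.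
Qed.

Lemma kernel_gram_dsum n m (Z : Omega n) (W : Omega m) (D : Omega (n + m)%N)
    u v x y l : val D = dsum z (val Z) (val W) ->
  kernel_gram l (idx D (row_mx u v) (col_mx x y)) =
  kernel_gram l (idx Z u x) +
  kernel_gram l (idx W v y).
Proof.
move=> hD; case: l => [[p V w t]|]; rewrite /= ?addr0//.
rewrite mul_mx_row (kernel_dsumr ncO glK _ _ _ hD).
by rewrite mxop_row_mx cdotDl.
Qed.

Lemma kernel_gram_ge0 i : 0 <= kernel_gram i i.
Proof.
case: i => [[n Z u x]|] //=; apply: cpK.
exact/cstar_psd_row/(nc_size_gt0 ncO Z).
Qed.

Lemma kernel_gram_colZ c n (Z : Omega n) u x l :
  kernel_gram l (idx Z u (map_mx ( *:%R c) x)) = c * kernel_gram l (idx Z u x).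
Proof. by case: l => [[m W w t]|]; rewrite /= ?mulr0// mxopZr cdotZl. Qed.

(** The nonnegative value at the direct sum expands into two diagonal terms, which are real, and
    this sum of cross terms. *)
Lemma kernel_gramD_real n m (Z : Omega n) (W : Omega m) u v x y :
  kernel_gram (idx Z u x) (idx W v y) + kernel_gram (idx W v y) (idx Z u x)
    \is Num.real.
Proof.
have [D hD] := nc_dsum ncO Z W; have [_ glob] := glK.
have iR := ger0_real (kernel_gram_ge0 (idx Z u x)).
have jR := ger0_real (kernel_gram_ge0 (idx W v y)).
have := ger0_real (kernel_gram_ge0 (idx D (row_mx u v) (col_mx x y))).
move: iR jR; rewrite /= starmx_row mul_col_row (glob _ _ _ _ _ _ _ _ _ _ hD hD).
rewrite mxop_block cdot_col_mx !cdotDl => iR jR.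
rewrite addrACA -addrA [X in _ + X]addrC -[X in _ + X]addrA => ijR.
by move: ijR; rewrite (rpredDl _ iR) addrCA (rpredDl _ jR).
Qed.

Lemma conjC_of_real (b b' : C) :
  b + b' \is Num.real -> 'i^* * b + 'i * b' \is Num.real -> b = b'^*.
Proof.
move=> /CrealP r1 /CrealP r2.
apply: (mulfI (_ : 2 * 'i != 0)); first by rewrite mulf_neq0 ?neq0Ci ?pnatr_eq0.
rewrite [LHS](_ : _ = 'i * (b + b') - ('i^* * b + 'i * b')); last by rewrite conjCi; ring.
by rewrite -r1 -r2 !rmorphD !rmorphM/= conjCK conjCi; ring.
Qed.

(** Polarization: the cross terms have a real sum for [u] and also for ['i] times [u], where they
    get the factors ['i^*] and ['i]; the two conditions force them to be conjugate. *)
Lemma kernel_gram_herm i j : kernel_gram i j = (kernel_gram j i)^*.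
Proof.
case: i j => [[n Z u x]|] [[m W v y]|]; rewrite ?kernel_gramNr/= ?conjC0//.
have r1 := kernel_gramD_real Z W u v x y.
have := kernel_gramD_real Z W (map_mx ( *:%R 'i) u) v x y.
rewrite /= starmxZ mulmxZl mulmxZr !kernelZ// !mxopZl !cdotZl.
exact: conjC_of_real.
Qed.

Lemma kernel_is_gram : is_gram kernel_gram.
Proof.
split=> [||c i j]; [exact: kernel_gram_herm|exact: kernel_gram_ge0|].
case: i j => [[n Z u x]|] [[m W v y]|].
- have [D hD] := nc_dsum ncO Z W.
  exists (idx D (row_mx u v) (col_mx (map_mx ( *:%R c) x) y)) => l.
  by rewrite (kernel_gram_dsum _ _ _ _ _ hD) kernel_gram_colZ.
- exists (idx Z u (map_mx ( *:%R c) x)) => l.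
  by rewrite kernel_gram_colZ kernel_gramNr addr0.
- by exists (idx W v y) => l; rewrite kernel_gramNr mulr0 add0r.
- by exists None => l; rewrite kernel_gramNr mulr0 addr0.
Qed.

(** The two sides differ by the diagonal value at the index with row [b%:M *m u], which is
    nonnegative. *)
Lemma kernel_gram_mul a n (Z : Omega n) u x :
  kernel_gram (idx Z (a%:M *m u) x) (idx Z (a%:M *m u) x) <=
  2 * algnorm a ^+ 2 * kernel_gram (idx Z u x) (idx Z u x).
Proof.
have [b Hb] := cstar_norm_bound a.
suff -> : 2 * algnorm a ^+ 2 * kernel_gram (idx Z u x) (idx Z u x) =
    kernel_gram (idx Z (b%:M *m u) x) (idx Z (b%:M *m u) x) +
    kernel_gram (idx Z (a%:M *m u) x) (idx Z (a%:M *m u) x).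
  by rewrite lerDr kernel_gram_ge0.
have mulP e : starmx (e%:M *m u) *m (e%:M *m u) = starmx u *m (star e * e)%:M *m u.
  by rewrite starmxM starmx_scalar !mulmxA -[_ *m _ *m e%:M]mulmxA -scalar_mxM.
rewrite /= !mulP -cdotDl -mxopDl -kernelD// -mulmxDl -mulmxDr -raddfD/= Hb subrK.
set c := 2 * _; rewrite (_ : c%:A%:M = map_mx ( *:%R c) 1%:M); last first.
  by apply/matrixP => i j; rewrite !mxE scalerMnr.
by rewrite mulmxZr mulmx1 mulmxZl kernelZ// mxopZl cdotZl.
Qed.

End KernelGram.

(** * The reproducing kernel Hilbert space of a cp global kernel *)

Lemma linear_mk (K : nzRingType) (U V : lmodType K) (f : U -> V) :
  linear f -> exists g : {linear U -> V}, g =1 f.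
Proof.
move=> fl; pose lf := GRing.isLinear.Build K U V *:%R f fl.
by exists (HB.pack_for {linear U -> V} f lf).
Qed.

(** The maps [t] and [t'] are formally adjoint: composition with [t'] sends the section at [i] to
    the section at [t i], and the norm bound on [t'] makes it preserve limits of sections. *)
Lemma rkhs_pullback (R : realType) (G : gram R) (t t' : gram_index G -> gram_index G)
    (c : R[i]) : 0 <= c ->
  (forall l i, G (t' l) i = G l (t i)) ->
  (forall l, gram_norm (t' l) <= c * gram_norm l) ->
  exists T : bounded_op (rkhs G) (rkhs G), forall f l, T f l = f (t' l).
Proof.
move=> c0 tt' tc.
have /choice[T TP] (f : rkhs G) : exists g : rkhs G, forall l, g l = f (t' l).
  suff fP : (fun l => f (t' l)) \in @rkhs_pred _ G by exists (RKHS fP).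
  rewrite inE => e e0; have c1 : 0 < c + 1 by rewrite ltr_wpDl.
  have ec0 : 0 < e / (c + 1) by rewrite divr_gt0.
  have [i fi] := rkhs_approx f ec0; exists (t i) => l.
  rewrite -tt'; apply: le_trans (fi (t' l)) _.
  apply: le_trans (ler_wpM2l (ltW ec0) (tc l)) _.
  rewrite mulrA ler_wpM2r ?gram_norm_ge0// mulrAC ler_pdivrMr// ler_pM2l//.
  by rewrite lerDl.
have [||T' T'T] := @bounded_op_mk _ (rkhs G) (rkhs G) T c.
- by move=> d f g; apply: rkhs_ext => l; rewrite rkhs_evalP !TP.
- move=> f; apply: rkhs_norm_le; first by rewrite mulr_ge0 ?rkhs_norm_ge0.
  move=> l; rewrite TP; apply: le_trans (gram_bounded_rkhs_norm f (t' l)) _.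
  rewrite [c * _]mulrC -mulrA; apply: ler_wpM2l; last exact: tc.
  exact: rkhs_norm_ge0.
by exists T' => f l; rewrite T'T TP.
Qed.

Section KernelRKHS.
Context {R : realType} {A : cstarAlgType R[i]} {Y : hilbertType R[i]}.
Context {S : Type} {Omega : forall n, set 'M[S]_n} (K : kernel_fun A Y Omega).
Arguments Omega : clear implicits.
Local Notation C := R[i].
Local Notation idx Z u x := (Some (KernelIndex Z u x)).

Variable z : S.
Hypotheses (gK : graded_kernel K) (ncO : nc_set z Omega).
Hypotheses (glK : global_kernel z K) (cpK : cp_kernel K).

Definition kernel_gram_struct : gram R :=
  Gram (kernel_is_gram gK ncO glK cpK) None.
Local Notation G := kernel_gram_struct.
Implicit Type f : rkhs G.

Lemma kernel_eval_row f c n (Z : Omega n) u v y :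
  f (idx Z (map_mx ( *:%R c) u + v) y) = c^* * f (idx Z u y) + f (idx Z v y).
Proof. by apply: rkhs_antilinear => l; exact: kernel_gram_row. Qed.

Lemma kernel_eval_col f c n (Z : Omega n) u x y :
  f (idx Z u (map_mx ( *:%R c) x + y)) = c^* * f (idx Z u x) + f (idx Z u y).
Proof. by apply: rkhs_antilinear => l; exact: kernel_gram_col. Qed.

Lemma kernel_eval_None f : f None = 0.
Proof.
apply: (addrI (f None)); rewrite addr0 -{1}[f None]mul1r -{1}(rmorph1 Num.conj).
by apply/esym/rkhs_antilinear => l; rewrite /= kernel_gramNr mulr0 addr0.
Qed.

Lemma kernel_eval_row_sum f n (Z : Omega n) y (I : Type) (r : seq I) (P : pred I) F :
  f (idx Z (\sum_(i <- r | P i) F i) y) = \sum_(i <- r | P i) f (idx Z (F i) y).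
Proof.
have D u v : f (idx Z (u + v) y) = f (idx Z u y) + f (idx Z v y).
  have := kernel_eval_row f 1 Z u v y; rewrite rmorph1 mul1r => <-.
  by congr (f (idx Z (_ + _) _)); apply/rowP => i; rewrite mxE scale1r.
apply: (big_morph (fun u => f (idx Z u y)) D).
by apply: (addrI (f (idx Z 0 y))); rewrite -D !addr0.
Qed.

Lemma kernel_eval_col_sum f n (Z : Omega n) u (I : Type) (r : seq I) (P : pred I) F :
  f (idx Z u (\sum_(i <- r | P i) F i)) = \sum_(i <- r | P i) f (idx Z u (F i)).
Proof.
have D x y : f (idx Z u (x + y)) = f (idx Z u x) + f (idx Z u y).
  have := kernel_eval_col f 1 Z u x y; rewrite rmorph1 mul1r => <-.
  by congr (f (idx Z u (_ + _))); apply/colP => i; rewrite mxE scale1r.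
apply: (big_morph (fun x => f (idx Z u x)) D).
by apply: (addrI (f (idx Z u 0))); rewrite -D !addr0.
Qed.

Lemma gram_norm_mul a n (Z : Omega n) u x :
  gram_norm (idx Z (a%:M *m u) x : gram_index G) <=
  2 * algnorm a * gram_norm (idx Z u x : gram_index G).
Proof.
have a0 := algnorm_ge0 a.
rewrite -ler_sqr ?nnegrE ?mulr_ge0 ?gram_norm_ge0// exprMn !gram_normK.
apply: le_trans (kernel_gram_mul gK ncO cpK a Z u x) _.
apply: ler_wpM2r; first exact: (kernel_gram_ge0 ncO cpK).
(* The inequality [2 |a|^2 <= (2 |a|)^2] trades the sharper constant for one without a square
   root. *)
rewrite exprMn ler_wpM2r ?exprn_ge0// expr2 ler_pMr//.
by rewrite ler1n.
Qed.

(** The squared norm is the quadratic form of the [(i, i)] entry of [K Z Z (starmx u *m u)] at [y],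
    and that entry is a bounded operator. *)
Lemma gram_norm_col_at n (Z : Omega n) u i : exists2 M, 0 <= M &
  forall y, gram_norm (idx Z u (col_at i y) : gram_index G) <= M * `|y|.
Proof.
have [M M0 KM] := bounded_op_norm (K Z Z (starmx u *m u) i i).
exists (sqrtC M); first by rewrite sqrtC_ge0.
move=> y; rewrite -ler_sqr ?nnegrE ?mulr_ge0 ?gram_norm_ge0 ?sqrtC_ge0//.
rewrite gram_normK exprMn sqrtCK /= cdot_col_at mxop_col_at.
apply: le_trans (real_ler_norm _) _.
  rewrite -mxop_col_at -cdot_col_at; apply: ger0_real.
  exact: (kernel_gram_ge0 ncO cpK (idx Z u (col_at i y))).
apply: le_trans (hdot_CauchySchwarz _ _) _.
by rewrite expr2 mulrA; apply: ler_wpM2r => //; exact: KM.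
Qed.

(** For fixed [a], Riesz' theorem represents the functional in [y], conjugated because [f] is
    antilinear in the column. The row carries [star a] so that the vector obtained is linear in [a]:
    [T] is the [(i, j)] entry of the value of [f] at [Z]. *)
Lemma kernel_eval_entry f n (Z : Omega n) i j :
  exists T : bounded_op (normed A) Y, forall a y,
    hdot (T a) y = f (idx Z ((star a)%:M *m delta_mx 0 j) (col_at i y)).
Proof.
have [M M0 ZM] := gram_norm_col_at Z (delta_mx 0 j) i.
have bnd a y : `|f (idx Z ((star a)%:M *m delta_mx 0 j) (col_at i y))| <=
    `|f| * (2 * algnorm a) * M * `|y|.
  apply: le_trans (gram_bounded_rkhs_norm f _) _.
  rewrite -!mulrA; apply: ler_wpM2l; first exact: rkhs_norm_ge0.
  apply: le_trans (gram_norm_mul _ _ _ _) _; rewrite algnorm_star mulrA.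
  by apply: ler_wpM2l => //; rewrite mulr_ge0 ?algnorm_ge0.
have /choice[T TP] a : exists t : Y, forall y,
    hdot t y = f (idx Z ((star a)%:M *m delta_mx 0 j) (col_at i y)).
  have [||t tP] := @Riesz_representation R Y
    (fun y => (f (idx Z ((star a)%:M *m delta_mx 0 j) (col_at i y)))^*)
    (`|f| * (2 * algnorm a) * M).
  - move=> c x y; rewrite col_atD col_atZ kernel_eval_col.
    by rewrite rmorphD rmorphM/= conjCK.
  - by move=> y; rewrite norm_conjC.
  by exists t => y; rewrite hdotC -tP conjCK.
have [||T' T'T] := @bounded_op_mk _ (normed A) Y T (`|f| * 2 * M).
- move=> c a b; apply: hdot_injl => y; rewrite hdotDl hdotZl !TP.
  rewrite starD starZ -[in RHS](conjCK c) -kernel_eval_row.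
  congr (f (idx Z _ _)); rewrite raddfD/= mulmxDl -mulmxZl; congr (_ *m _ + _).
  by apply/matrixP => k l; rewrite !mxE scalerMnr.
- move=> a; apply: hnorm_le.
    by rewrite !mulr_ge0.
  move=> y; rewrite TP; apply: le_trans (bnd a y) _.
  by rewrite -[algnorm a]/(`|a|) mulrA [_ * _ * M]mulrAC.
by exists T' => a y; rewrite T'T TP.
Qed.

Lemma kernel_eval_ex f n (Z : Omega n) :
  exists T : 'M[bounded_op (normed A) Y]_n, forall v y,
    cdot (mxop T (starmx v : 'cV[normed A]_n)) y = f (idx Z v y).
Proof.
have /choice[T TP] i : exists T : 'I_n -> bounded_op (normed A) Y, forall j a y,
    hdot (T j a) y = f (idx Z ((star a)%:M *m delta_mx 0 j) (col_at i y)).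
  by have /choice[T TP] := kernel_eval_entry f Z i; exists T.
exists (\matrix_(i, j) T i j) => v y.
rewrite {2}[y]col_sum_at kernel_eval_col_sum; apply: eq_bigr => i _.
rewrite mxE hdot_suml {2}[v]row_sum_delta kernel_eval_row_sum.
apply: eq_bigr => j _; rewrite !mxE TP starK; congr (f (idx Z _ _)).
by rewrite mul_scalar_mx.
Qed.

Definition kernel_eval f : graded_fun Omega (bounded_op (normed A) Y) :=
  fun n Z => projT1 (cid (kernel_eval_ex f Z)).

Lemma kernel_evalP f n (Z : Omega n) v y :
  cdot (mxop (kernel_eval f Z) (starmx v : 'cV[normed A]_n)) y = f (idx Z v y).
Proof. by rewrite /kernel_eval; case: cid. Qed.

Lemma kernel_eval_unique f n (Z : Omega n) (T : 'M[bounded_op (normed A) Y]_n) :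
  (forall v y, cdot (mxop T (starmx v : 'cV[normed A]_n)) y = f (idx Z v y)) ->
  kernel_eval f Z = T.
Proof.
move=> TP; apply: mxop_inj => u; apply: cdot_inj => y.
by rewrite -[u]starmxK kernel_evalP TP.
Qed.

Definition index_mul (a : A) (l : option (@kernel_index R A Y S Omega)) :=
  if l is Some (KernelIndex n Z u x) then idx Z (a%:M *m u) x else None.

Lemma kernel_gram_index_mul a l i :
  kernel_gram K (index_mul (star a) l) i = kernel_gram K l (index_mul a i).
Proof.
case: l i => [[n Z u x]|] [[m W v y]|]//=.
by rewrite starmxM starmx_scalar starK mulmxA.
Qed.

Lemma kernel_sigma_ex a : exists T : bounded_op (rkhs G) (rkhs G),
  forall f l, T f l = f (index_mul (star a) l).
Proof.
apply: (@rkhs_pullback _ G (index_mul a) (index_mul (star a)) (2 * algnorm a)).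
- by rewrite mulr_ge0 ?algnorm_ge0.
- by move=> l i; exact: kernel_gram_index_mul.
- case=> [[n Z u x]|]; first by rewrite -algnorm_star; exact: gram_norm_mul.
  by rewrite /gram_norm/= sqrtC0 mulr0.
Qed.

(** No class of functions is imposed here: membership is deduced afterwards from the reproducing
    property, so one construction serves both settings. *)
Lemma kernel_has_rkhs : has_rkhs (fun _ _ => True) K.
Proof.
pose s a := projT1 (cid (kernel_sigma_ex a)).
have sP a f l : s a f l = f (index_mul (star a) l) by rewrite /s; case: cid.
have [|sigma sigmaE] := @linear_mk _ _ _ s.
  move=> c a b; apply: bounded_op_ext => f; apply: rkhs_ext => l.
  rewrite bounded_opDE bounded_opZE rkhs_evalP !sP.
  case: l => [[n Z u x]|]; last by rewrite /= !kernel_eval_None mulr0 addr0.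
  rewrite /= starD starZ -[in RHS](conjCK c) -kernel_eval_row.
  congr (f (idx Z _ _)); rewrite raddfD/= mulmxDl -mulmxZl; congr (_ *m _ + _).
  by apply/matrixP => k l; rewrite !mxE scalerMnr.
pose k m (W : Omega m) v y : rkhs G := rkhs_section (idx W v y : gram_index G).
have sigma_section a l : sigma a (rkhs_section (l : gram_index G)) =
    rkhs_section (index_mul a l : gram_index G).
  by apply: rkhs_ext => l'; rewrite sigmaE sP; exact: kernel_gram_index_mul.
exists (rkhs G), kernel_eval, k, sigma; split; split=> //.
- move=> f g fg; apply: rkhs_ext => -[[n Z u x]|]; last by rewrite !kernel_eval_None.
  by rewrite -!kernel_evalP fg.
- move=> c f g n Z; apply: kernel_eval_unique => v y.
  by rewrite mxopDl mxopZl cdotDl cdotZl !kernel_evalP.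
- move=> m W v y n Z u; apply: cdot_inj => x.
  by rewrite -[u in LHS]starmxK kernel_evalP /= starmxK.
- by move=> f m W v y; rewrite kernel_evalP hdot_section.
- split.
  + split.
    * apply/funext => f; apply: rkhs_ext => l; rewrite sigmaE sP.
      by case: l => [[n Z u x]|]//=; rewrite star1 mul1mx.
    * move=> a b; apply/funext => f; apply: rkhs_ext => l /=; rewrite !sigmaE !sP.
      by case: l => [[n Z u x]|]//=; rewrite starM scalar_mxM mulmxA.
    (* Evaluation at [l] is the inner product with its section, which [sigma a] sends to the section
       of [index_mul a l]. *)
    * move=> a; apply: bounded_op_ext => f; apply: rkhs_ext => l.
      rewrite sigmaE sP starK -[RHS]hdot_section hdotC -adjointP sigma_section.
      by rewrite -hdotC hdot_section.
  + move=> a f m W v; apply: cdot_inj => y; rewrite kernel_evalP sigmaE sP /=.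
    rewrite -kernel_evalP starmxM starmx_scalar starK//.
  + by move=> a m W v y; rewrite sigma_section.
Qed.

End KernelRKHS.

(** * Kolmogorov decompositions *)

Section FunctionClass.
Context {R : realType} {A : cstarAlgType R[i]} {Y : hilbertType R[i]}.
Local Notation C := R[i].

Lemma starmx_delta n (j : 'I_n) : starmx (delta_mx 0 j : 'rV[A]_n) = col_at j 1.
Proof.
apply/colP => k; rewrite !mxE eqxx/=; case: eqP => _; first exact: star1.
exact: star0.
Qed.

(** By (b), the direct sum rule for every [f] reduces to the additivity [k D (v1 v2) (y1; y2) = k Z
    v1 y1 + k W v2 y2] of kernel elements; since [ev] is injective, (a) reduces this to
    [kernel_dsumr]. *)
Lemma has_rkhs_global (S : Type) (z : S) (Omega : forall n, set 'M[S]_n)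
    (K : kernel_fun A Y Omega) :
  nc_set z Omega -> global_kernel z K ->
  has_rkhs (fun _ _ => True) K -> has_rkhs (global_fun z) K.
Proof.
move=> ncO glK [HK [ev [k [sigma [[inj lin _] [Ka Kb Kc]]]]]].
exists HK, ev, k, sigma; split; split=> // f n m Z W D hD.
apply: mxop_inj => u; apply: cdot_inj => y.
rewrite -[u]starmxK -[starmx u]hsubmxK -[y]vsubmxK Kb starmx_row mxop_block.
rewrite cdot_col_mx !mxop0l addr0 add0r !Kb -hdotDr; congr (hdot f _).
move: (lsubmx _) (rsubmx _) (usubmx y) (dsubmx y) => v1 v2 y1 y2.
apply: inj; apply: functional_extensionality_dep => p.
apply: functional_extensionality_dep => V.
rewrite -[k _ Z v1 y1]scale1r lin map_scale1; apply: mxop_inj => w.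
rewrite mxopDl !Ka mul_mx_row (kernel_dsumr ncO glK _ _ _ hD).
by rewrite mxop_row_mx.
Qed.

(** Pairing with [y] leaves one identity of kernel elements: multiplying the column by [ctrmx a] at
    [Z] equals multiplying the row by [ctrmx a] at [W]. This is the intertwining property of [K] in
    its second argument, with the identity matrix in the first. *)
Lemma has_rkhs_nc (V : lmodType C) (Omega : forall n, set 'M[V]_n)
    (K : kernel_fun A Y Omega) :
  nc_kernel K -> has_rkhs (fun _ _ => True) K -> has_rkhs nc_fun K.
Proof.
move=> [_ ncK] [HK [ev [k [sigma [[inj lin _] [Ka Kb Kc]]]]]].
exists HK, ev, k, sigma; split; split=> // f n m Z W a aZ.
apply: mxop_inj => u; apply: cdot_inj => y.
rewrite mxop_lmulmx mxop_rmulmx cdot_lmulmx -[u]starmxK.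
have -> : lmulmx a (starmx (starmx u)) = starmx (rmulmx (starmx u) (ctrmx a)).
  by rewrite starmx_rmulmx ctrmxK.
rewrite !Kb; congr (hdot f _); move: (starmx u) => v.
apply: inj; apply: functional_extensionality_dep => p.
apply: functional_extensionality_dep => W'; apply: mxop_inj => w.
rewrite !Ka mulmx_rmulmx -mxop_rmulmx.
have := ncK _ _ _ _ W' W' 1%:M Z W a (w *m v).
by rewrite !lmul1mx rmulmx1 => ->.
Qed.

(** The coordinate projections intertwine a direct sum with its summands, and compressing by them
    extracts the four blocks. *)
Lemma nc_global_kernel (V : lmodType C) (Omega : forall n, set 'M[V]_n)
    (K : kernel_fun A Y Omega) :
  nc_kernel K -> global_kernel 0 K.
Proof.
move=> [gK ncK]; split=> // n n' m m' Z Z' D W W' E hD hE P11 P12 P21 P22.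
have upi (T : lmodType C) p p' q (M : 'M[T]_(p + p', q)) :
    lmulmx (row_mx 1%:M 0) M = usubmx M.
  by rewrite -{1}[M]vsubmxK lmul_row_col lmul1mx lmul0mx addr0.
have dpi (T : lmodType C) p p' q (M : 'M[T]_(p + p', q)) :
    lmulmx (row_mx 0 1%:M) M = dsubmx M.
  by rewrite -{1}[M]vsubmxK lmul_row_col lmul1mx lmul0mx add0r.
have lpi (T : lmodType C) p q q' (M : 'M[T]_(p, q + q')) :
    rmulmx M (ctrmx (row_mx 1%:M 0)) = lsubmx M.
  rewrite -{1}[M]hsubmxK ctrmx_row ctrmx1 rmul_row_col rmulmx1.
  by rewrite (_ : ctrmx 0 = 0) ?rmulmx0 ?addr0// /ctrmx trmx0 map_mx0.
have rpi (T : lmodType C) p q q' (M : 'M[T]_(p, q + q')) :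
    rmulmx M (ctrmx (row_mx 0 1%:M)) = rsubmx M.
  rewrite -{1}[M]hsubmxK ctrmx_row ctrmx1 rmul_row_col rmulmx1.
  by rewrite (_ : ctrmx 0 = 0) ?rmulmx0 ?add0r// /ctrmx trmx0 map_mx0.
have uint p p' (U : 'M[V]_p) (U' : 'M[V]_p') :
    lmulmx (row_mx 1%:M 0) (dsum 0 U U') = rmulmx U (row_mx 1%:M 0).
  by rewrite upi /dsum block_mxEv col_mxKu rmul_mx_row rmulmx1 rmulmx0.
have dint p p' (U : 'M[V]_p) (U' : 'M[V]_p') :
    lmulmx (row_mx 0 1%:M) (dsum 0 U U') = rmulmx U' (row_mx 0 1%:M).
  by rewrite dpi /dsum block_mxEv col_mxKd rmul_mx_row rmulmx1 rmulmx0.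
set P := block_mx P11 P12 P21 P22; rewrite -[LHS]submxK; congr block_mx.
- have := ncK _ _ _ _ D Z (row_mx 1%:M 0) E W (row_mx 1%:M 0) P.
  by rewrite hD hE !uint !upi !lpi -[lsubmx (usubmx P)]/(ulsubmx P) block_mxKul; apply.
- have := ncK _ _ _ _ D Z (row_mx 1%:M 0) E W' (row_mx 0 1%:M) P.
  by rewrite hD hE uint dint !upi !rpi -[rsubmx (usubmx P)]/(ursubmx P) block_mxKur; apply.
- have := ncK _ _ _ _ D Z' (row_mx 0 1%:M) E W (row_mx 1%:M 0) P.
  by rewrite hD hE uint dint !dpi !lpi -[lsubmx (dsubmx P)]/(dlsubmx P) block_mxKdl; apply.
- have := ncK _ _ _ _ D Z' (row_mx 0 1%:M) E W' (row_mx 0 1%:M) P.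
  by rewrite hD hE !dint !dpi !rpi -[rsubmx (dsubmx P)]/(drsubmx P) block_mxKdr; apply.
Qed.

(** This isolates what the passage to a decomposition asks of a class of functions, so that one
    proof covers global and nc functions. *)
Definition evaluation_closed (S : Type) (Omega : forall n, set 'M[S]_n)
    (F : forall T : lmodType C, graded_fun Omega T -> Prop) :=
  forall (X : hilbertType C) (ev : X -> graded_fun Omega (bounded_op (normed A) Y))
    (H : graded_fun Omega (bounded_op X Y)),
  (forall f n (Z : Omega n) i j, H _ Z i j f = ev f _ Z i j (1 : A)) ->
  (forall f, F _ (ev f)) -> F _ H.

Lemma global_evaluation_closed (S : Type) (z : S) (Omega : forall n, set 'M[S]_n) :
  @evaluation_closed S Omega (global_fun z).
Proof.
move=> X ev H HE evF n m Z W D hD.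
apply/matrixP => i j; apply: bounded_op_ext => f; rewrite HE (evF f _ _ _ _ _ hD).
rewrite !mxE; case: splitP => k _; rewrite !mxE; case: splitP => l _;
  by rewrite ?HE// !mxE.
Qed.

Lemma nc_evaluation_closed (V : lmodType C) (Omega : forall n, set 'M[V]_n) :
  @evaluation_closed V Omega nc_fun.
Proof.
move=> X ev H HE evF n m Z W a aZ.
apply/matrixP => i j; apply: bounded_op_ext => f.
have /matrixP/(_ i j) := evF f _ _ _ _ _ aZ; rewrite !mxE.
move=> /(congr1 (fun T : bounded_op (normed A) Y => T (1 : A))).
rewrite !bounded_op_sumE; under eq_bigr do rewrite bounded_opZE -HE.
under [in X in _ = X]eq_bigr do rewrite bounded_opZE -HE.
by [].
Qed.

End FunctionClass.

(** * From H(K) to a decomposition, and from a decomposition to the kernel *)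

Section Kolmogorov.
Context {R : realType} {A : cstarAlgType R[i]} {Y : hilbertType R[i]}.
Context {S : Type} {Omega : forall n, set 'M[S]_n} (K : kernel_fun A Y Omega).
Arguments Omega : clear implicits.
Local Notation C := R[i].
Hypothesis gK : graded_kernel K.

Lemma rkhs_kolmogorov (F : forall T : lmodType C, graded_fun Omega T -> Prop) :
  @evaluation_closed R A Y S Omega F -> has_rkhs F K -> has_kolmogorov F K.
Proof.
move=> Fclosed [X [ev [k [sigma [[inj lin evF] [Ka Kb [srep _ sk]]]]]]].
have ev1 f n (Z : Omega n) j y :
    cdot (mxop (ev f n Z) (col_at j (1 : normed A))) y = hdot f (k n Z (delta_mx 0 j) y).
  by rewrite -Kb starmx_delta.
(* Boundedness in [f]: the pairing with [y] is the inner product of [f] with a kernel element, whose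
   squared norm is the quadratic form at [y] of an entry of [K Z Z P]. *)
have entry n (Z : Omega n) i j : exists T : bounded_op X Y,
    forall f, T f = ev f n Z i j (1 : A).
  pose P := starmx (delta_mx 0 j : 'rV[A]_n) *m delta_mx 0 j.
  have [M M0 KM] := bounded_op_norm (K Z Z P i i).
  have kM y : `|k n Z (delta_mx 0 j) (col_at i y)| <= sqrtC M * `|y|.
    rewrite -ler_sqr ?nnegrE ?mulr_ge0 ?sqrtC_ge0// exprMn sqrtCK hdot_norm.
    rewrite -Kb Ka cdot_col_at mxop_col_at; apply: le_trans (real_ler_norm _) _.
      rewrite -mxop_col_at -cdot_col_at -Ka Kb; apply: ger0_real; exact: hdot_ge0.
    apply: le_trans (hdot_CauchySchwarz _ _) _.
    by rewrite expr2 mulrA; apply: ler_wpM2r => //; exact: KM.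
  have [||T TE] := @bounded_op_mk _ X Y (fun f => ev f n Z i j (1 : A)) (sqrtC M).
  - by move=> c f g; rewrite lin mxE bounded_opDE mxE bounded_opZE.
  - move=> f; apply: hnorm_le; first by rewrite mulr_ge0 ?sqrtC_ge0.
    move=> y; rewrite -mxop_col_at -cdot_col_at ev1.
    apply: le_trans (hdot_CauchySchwarz _ _) _.
    rewrite mulrAC [leRHS]mulrC; exact: ler_wpM2l.
  by exists T.
have Hex n (Z : Omega n) : exists T : 'M[bounded_op X Y]_n,
    forall f i j, T i j f = ev f n Z i j (1 : A).
  have /choice[T TP] i : exists T : 'I_n -> bounded_op X Y,
      forall j f, T j f = ev f n Z i j (1 : A).
    by have /choice[T TP] := entry n Z i; exists T.
  by exists (\matrix_(i, j) T i j) => f i j; rewrite mxE TP.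
pose H : graded_fun Omega (bounded_op X Y) := fun n Z => projT1 (cid (Hex n Z)).
have HE f n (Z : Omega n) i j : H n Z i j f = ev f n Z i j (1 : A).
  by rewrite /H; case: cid => T /= ->.
have adjH m (W : Omega m) y : mxop (adjointmx (H m W)) y = \col_j k m W (delta_mx 0 j) y.
  apply/colP => j; apply: hdot_inj => f; rewrite [in RHS]mxE -ev1.
  rewrite -cdot_col_atl -cdot_mxop; congr (cdot _ y); apply/colP => i.
  by rewrite !mxop_col_at HE.
exists X, sigma, H; split=> //; first exact: (Fclosed X ev).
move=> n m Z W P; apply/funext => y; apply/colP => l.
rewrite /= adjH [RHS]mxE.
have kD u v : k m W (u + v) y = k m W u y + k m W v y.
  by apply: hdot_inj => f; rewrite hdotDr -!Kb starmxD mxopDr cdotDl.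
have k0 : k m W 0 y = 0 by apply: (addrI (k m W 0 y)); rewrite -kD !addr0.
(* By (c), [sigma] combines the kernel elements of the unit rows into the one of row [i] of [P]. *)
have krow i : mxop (map_mx sigma P) (\col_j k m W (delta_mx 0 j) y) i 0 =
    k m W (row i P) y.
  rewrite [row i P]row_sum_delta (big_morph (fun v => k m W v y) kD k0) mxE.
  by apply: eq_bigr => j _; rewrite !mxE sk mul_scalar_mx.
under [RHS]eq_bigr do rewrite krow HE -mxop_col_at -starmx_delta Ka.
rewrite -summxE -mxop_suml -(kernel_sum gK); congr (mxop (K Z W _) y l 0).
(* What remains is that [P] is the sum over [i] of the unit column at [i] times its row [i]. *)
apply/matrixP => a b; rewrite summxE (bigD1 a)//= mxE big_ord1 !mxE !eqxx/=.
rewrite star1 mul1r big1 ?addr0// => i ia.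
by rewrite mxE big_ord1 !mxE [a == i]eq_sym (negPf ia) andbF star0 mul0r.
Qed.

Lemma adjointmx_block (X : hilbertType C) n m n' m' (T : 'M[bounded_op X Y]_(n, m))
    (T' : 'M[bounded_op X Y]_(n', m')) :
  adjointmx (block_mx T 0 0 T') = block_mx (adjointmx T) 0 0 (adjointmx T').
Proof.
have adj0 : adjoint (0 : bounded_op X Y) = 0.
  by apply/esym/adjoint_unique => x y; rewrite !bounded_op0E hdot0l hdot0r.
rewrite /adjointmx tr_block_mx map_block_mx !trmx0; congr block_mx;
  by apply/matrixP => i j; rewrite !mxE adj0.
Qed.

Section FromDecomposition.
Variables (X : hilbertType C) (sigma : {linear A -> bounded_op X X}).
Hypothesis srep : unital_star_rep sigma.

Lemma mxop_sigmaM n m p (P : 'M[A]_(n, m)) (Q : 'M_(m, p)) x :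
  mxop (map_mx sigma (P *m Q)) x = mxop (map_mx sigma P) (mxop (map_mx sigma Q) x).
Proof.
have [_ sM _] := srep; apply/colP => i; rewrite !mxE.
under eq_bigr do rewrite !mxE raddf_sum bounded_op_sumE.
rewrite exchange_big; apply: eq_bigr => k _; rewrite !mxE bounded_op_sum.
by apply: eq_bigr => j _; rewrite !mxE sM.
Qed.

Lemma adjointmx_sigma n m (P : 'M[A]_(n, m)) :
  map_mx sigma (starmx P) = adjointmx (map_mx sigma P).
Proof. by have [_ _ sS] := srep; apply/matrixP => i j; rewrite !mxE sS. Qed.

Variable H : graded_fun Omega (bounded_op X Y).
Hypothesis KH : forall n m (Z : Omega n) (W : Omega m) (P : 'M[A]_(n, m)),
  mxop (K Z W P) = mxop (H Z) \o mxop (map_mx sigma P) \o mxop (adjointmx (H W)).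

(** For [P = starmx B *m B] the quadratic form at [y] is the squared norm of [sigma(B) H(Z)^* y]. *)
Lemma kolmogorov_cp : cp_kernel K.
Proof.
move=> n Z _ [B ->] y; rewrite KH /= cdot_mxop mxop_sigmaM adjointmx_sigma.
by rewrite cdotC -cdot_mxop -cdotC cdot_ge0.
Qed.

Lemma kolmogorov_global z : global_fun z _ H -> global_kernel z K.
Proof.
move=> glH; split=> // n n' m m' Z Z' D W W' E hD hE P11 P12 P21 P22.
apply: mxop_inj => x; rewrite -[x]vsubmxK mxop_block !KH /=.
rewrite (glH _ _ _ _ _ hD) (glH _ _ _ _ _ hE) adjointmx_block map_block_mx.
by rewrite !mxop_block !mxop0l !(addr0, add0r) !mxopDr.
Qed.

End FromDecomposition.

Lemma kolmogorov_global_kernel z :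
  has_kolmogorov (global_fun z) K -> global_kernel z K /\ cp_kernel K.
Proof.
move=> [X [sigma [H [srep glH KH]]]]; split; last exact: kolmogorov_cp KH.
exact (kolmogorov_global KH glH).
Qed.

End Kolmogorov.

Section NcKolmogorov.
Context {R : realType} {A : cstarAlgType R[i]} {Y : hilbertType R[i]}.
Local Notation C := R[i].

Lemma kolmogorov_nc_kernel (V : lmodType C) (Omega : forall n, set 'M[V]_n)
    (K : kernel_fun A Y Omega) :
  graded_kernel K -> has_kolmogorov nc_fun K -> nc_kernel K /\ cp_kernel K.
Proof.
move=> gK [X [sigma [H [srep ncH KH]]]]; split; last exact: kolmogorov_cp KH.
split=> // n n' m m' Z Z' a W W' b P aZ bW; apply: mxop_inj => x.
rewrite mxop_rmulmx mxop_lmulmx !KH /=.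
have sZ c (u : A) : sigma (c *: u) = c *: sigma u.
  by have := linearP sigma c u 0; rewrite raddf0 !addr0.
have -> : map_mx sigma (rmulmx (lmulmx a P) (ctrmx b)) =
    rmulmx (lmulmx a (map_mx sigma P)) (ctrmx b).
  apply/matrixP => i j; rewrite !mxE raddf_sum; apply: eq_bigr => k _.
  apply: etrans (sZ _ _) _; rewrite !mxE raddf_sum; congr (_ *: _).
  by apply: eq_bigr => l _; apply: etrans (sZ _ _) _; rewrite mxE.
rewrite mxop_rmulmx mxop_lmulmx -[in RHS]mxop_rmulmx -(ncH _ _ _ _ _ aZ) mxop_lmulmx.
(* What remains is [H(W)^* b^* = b^* H(W')^*], the adjoint of the intertwining relation, tested
   against [w]. *)
congr (lmulmx a (mxop _ (mxop _ _))); apply: cdot_inj => w.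
rewrite [LHS]cdotC -cdot_mxop -[in LHS]cdot_lmulmx -[in LHS]mxop_lmulmx.
rewrite (ncH _ _ _ _ _ bW).
by rewrite mxop_rmulmx cdot_mxop [in LHS]cdot_lmulmx -cdotC.
Qed.

End NcKolmogorov.

Theorem theorem3p1 (R : realType) (A : cstarAlgType R[i])
    (Y : hilbertType R[i]) :
  (forall (S : Type) (z : S) (Omega : forall n : nat, set 'M[S]_n)
      (K : kernel_fun A Y Omega),
    nc_set z Omega -> graded_kernel K ->
    [<-> global_kernel z K /\ cp_kernel K;
         has_rkhs (global_fun z) K;
         has_kolmogorov (global_fun z) K])
  /\
  (forall (V : lmodType R[i]) (Omega : forall n : nat, set 'M[V]_n)
      (K : kernel_fun A Y Omega),
    nc_set 0 Omega -> graded_kernel K ->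
    [<-> nc_kernel K /\ cp_kernel K;
         has_rkhs nc_fun K;
         has_kolmogorov nc_fun K]).
Proof.
split=> [S z Omega K ncO gK|V Omega K ncO gK]; tfae.
- move=> [glK cpK]; apply: (has_rkhs_global ncO glK).
  exact: kernel_has_rkhs gK ncO glK cpK.
- apply: (rkhs_kolmogorov gK); exact: global_evaluation_closed.
- exact: kolmogorov_global_kernel gK z.
- move=> [ncK cpK]; apply: (has_rkhs_nc ncK).
  exact: kernel_has_rkhs gK ncO (nc_global_kernel ncK) cpK.
- apply: (rkhs_kolmogorov gK); exact: nc_evaluation_closed.
- exact: kolmogorov_nc_kernel gK.
Qed.
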